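(* There exist an absolute constant $C>0$ and an adaptive algorithm for the distribution 2-clustering problem in which one of the two cluster distributions, $Q$, is a known distribution on $[n]$ and the other, $P$, is unknown. Given $n,k,\varepsilon$, the description of $Q$, and $r$ (the number of indices $i$ with $D_i=P$), the algorithm outputs the hidden partition with probability at least $2/3$, using at most $$C\left(\frac{k\log k\sqrt n}{r\varepsilon^2}+\frac{\sqrt{nk\log k}}{\varepsilon^2}\right)\ \text{ samples if } n\ge k\log k,\qquad C\left(\frac{k\log k\sqrt n}{r\varepsilon^2}+\frac{k\log k}{\varepsilon^2}\right)\ \text{ samples if } n\le k\log k.$$
   Context: Distribution 2-clustering problem: the input is sample access (adaptive, independent samples on request) to $k\ge2$ distributions $D_1,\dots,D_k$ on $[n]$ and a parameter $\varepsilon\in(0,1]$; it is promised that there is a hidden partition $\{\mathcal I_1,\mathcal I_2\}$ of $[k]$ into two nonempty parts such that all $D_a$ with $a$ in the same part are equal, and $\mathrm{d_{TV}}(D_a,D_b)\ge\varepsilon$ whenever $a\in\mathcal I_1$, $b\in\mathcal I_2$. The goal is to output the partition. $\mathrm{d_{TV}}$ is total variation distance; sample complexity is the total number of samples drawn. *)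

(* Defs.v *)
From HB Require Import structures.
From mathcomp Require Import all_boot all_order all_algebra.
From mathcomp Require Import reals exp.
Set Implicit Arguments. Unset Strict Implicit. Unset Printing Implicit Defensive.
Import Order.TTheory GRing.Theory Num.Theory.
Local Open Scope ring_scope.

Definition is_dist (R : realType) (n : nat) (p : 'I_n -> R) : Prop :=
  (forall x, 0 <= p x) /\ \sum_(x < n) p x = 1.

Definition dTV (R : realType) (n : nat) (p q : 'I_n -> R) : R :=
  2^-1 * \sum_(x < n) `|p x - q x|.

(* Adaptive randomized sampling algorithms for k distributions on [n],
   as finite decision trees:
   - [Leaf S]     : halt, output the partition {S, [k] \ S};
   - [Query a f]  : draw a fresh independent sample x ~ D_a, continue with f x;
   - [Coin f]     : flip a fresh fair internal coin b, continue with f b. *)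
Inductive alg (n k : nat) : Type :=
| Leaf of {set 'I_k}
| Query of 'I_k & ('I_n -> alg n k)
| Coin of (bool -> alg n k).

Fixpoint prob_out (R : realType) (n k : nat) (D : 'I_k -> 'I_n -> R)
    (good : {set 'I_k} -> bool) (T : alg n k) : R :=
  match T with
  | Leaf out => if good out then 1 else 0
  | Query a f => \sum_(x < n) D a x * prob_out D good (f x)
  | Coin f => 2^-1 * (prob_out D good (f false) + prob_out D good (f true))
  end.

Fixpoint num_samples (n k : nat) (T : alg n k) : nat :=
  match T with
  | Leaf _ => 0
  | Query _ f => (\max_(x < n) num_samples (f x)).+1
  | Coin f => maxn (num_samples (f false)) (num_samples (f true))
  end.

Definition correct_partition (k : nat) (I : {set 'I_k}) (S : {set 'I_k}) : bool :=
  (S == I) || (S == ~: I).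

Definition sample_bound (R : realType) (n k r : nat) (eps : R) : R :=
  let klk := k%:R * ln (k%:R) in
  klk * Num.sqrt (n%:R) / (r%:R * eps ^+ 2) +
  (if klk <= n%:R then Num.sqrt (n%:R * klk) / eps ^+ 2 else klk / eps ^+ 2).

(* Main.v *)
Require Import Defs.
From HB Require Import structures.
From mathcomp Require Import all_boot all_order all_algebra.
From mathcomp Require Import reals exp.
From mathcomp Require Import ring lra.
Import Order.TTheory GRing.Theory Num.Theory.
Local Open Scope ring_scope.
Set Implicit Arguments. Unset Strict Implicit. Unset Printing Implicit Defensive.

(** Since [Q] is known, each point can be split by fair coins into equally likely
    copies so that every copy has [Q]-mass at most [1/(2n)] and there are at most [5n]
    copies. To decide whether [D_j] is [P] or [Q], given reference samples [X] and test
    samples [Y] from [D_j], cut [X] into [b] blocks of [t <= n] samples, and let [f x] be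
    the fraction of blocks containing [x], centred by its mean under [Q]. The mean of [f]
    has the sign of [P - Q] at every point, and block membership is a bounded statistic,
    so heavy points of [P] do not spoil the variance: the excess of the average of [f]
    over [Y] above its [Q]-mean is large if [X] and [Y] both come from [P], and small
    if [Y] comes from [Q] whatever [X] is, as soon as [|X| |Y| >= c n / eps^4],
    [|Y| >= c / eps^2] and [|X| >= c sqrt n / eps^2]. Majority votes over [O(log k)]
    repetitions bring the error below [1/(400 k)].

    The algorithm first looks for an index of the [P]-cluster among [O(k/r)] random
    indices, drawing [X] and [Y] from the same index with [|X| = |Y|]. It then draws one
    large reference [X] from the index found and reuses it to test all [k] indices,
    balancing [|X|] against [k log k |Y|]. *)

(** * Expectation functionals *)

Section Expectation.
Variable R : realType.

(** Finite distributions, lists of independent draws and the semantics of programs are all treated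
    as positive normalised linear functionals, so one small theory serves the three. *)
Record expectation (A : Type) (E : (A -> R) -> R) : Prop := Expectation {
  expectD : forall f g, E (fun a => f a + g a) = E f + E g;
  expectZ : forall c f, E (fun a => c * f a) = c * E f;
  expect_ge0 : forall f, (forall a, 0 <= f a) -> 0 <= E f;
  expect1 : E (fun=> 1) = 1 }.

Section Theory.
Variables (A : Type) (E : (A -> R) -> R) (hE : expectation E).

Lemma expect_le f g : (forall a, f a <= g a) -> E f <= E g.
Proof.
move=> h; have : 0 <= E (fun a => g a + (-1) * f a).
  by apply: (expect_ge0 hE) => a; rewrite mulN1r subr_ge0.
by rewrite (expectD hE) (expectZ hE) mulN1r subr_ge0.
Qed.

(** Monotonicity in both directions replaces functional extensionality. *)
Lemma eq_expect f g : f =1 g -> E f = E g.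
Proof. by move=> h; apply: le_anti; rewrite !expect_le // => a; rewrite h. Qed.

Lemma expect_cst c : E (fun=> c) = c.
Proof.
by rewrite -[RHS]mulr1 -(expect1 hE) -(expectZ hE); apply: eq_expect => a; rewrite mulr1.
Qed.

Lemma expectB f g : E (fun a => f a - g a) = E f - E g.
Proof.
rewrite -[- E g]mulN1r -(expectZ hE) -(expectD hE).
by apply: eq_expect => a; rewrite mulN1r.
Qed.

Lemma expect_sum (I : Type) (r : seq I) (F : I -> A -> R) :
  E (fun a => \sum_(i <- r) F i a) = \sum_(i <- r) E (F i).
Proof.
elim: r => [|i r IH].
  by rewrite big_nil -[RHS]expect_cst; apply: eq_expect => a; rewrite big_nil.
by rewrite big_cons -IH -(expectD hE); apply: eq_expect => a; rewrite big_cons.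
Qed.

Lemma sqr_expect_le f : E f ^+ 2 <= E (fun a => f a ^+ 2).
Proof.
have : 0 <= E (fun a => (f a - E f) ^+ 2).
  by apply: (expect_ge0 hE) => a; apply: sqr_ge0.
rewrite (@eq_expect _ (fun a => f a ^+ 2 + ((- 2 * E f) * f a + E f ^+ 2))).
  by rewrite (expectD hE) (expectD hE) (expectZ hE) expect_cst; nra.
by move=> a; ring.
Qed.

End Theory.

Fixpoint iid (A : Type) (E : (A -> R) -> R) (L : nat) : (seq A -> R) -> R :=
  if L is L'.+1 then fun g => E (fun a => iid E L' (fun l => g (a :: l)))
  else fun g => g [::].

Lemma expectation_iid A (E : (A -> R) -> R) L : expectation E -> expectation (iid E L).
Proof.
move=> hE; elim: L => [|L IH] //=; split.
- move=> f g; rewrite -(expectD hE); apply: (eq_expect hE) => a.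
  by rewrite -(expectD IH).
- move=> c f; rewrite -(expectZ hE); apply: (eq_expect hE) => a.
  by rewrite -(expectZ IH).
- by move=> f h; apply: (expect_ge0 hE) => a; apply: (expect_ge0 IH).
- by rewrite -[RHS](expect1 hE); apply: (eq_expect hE) => a; rewrite (expect1 IH).
Qed.

Lemma eq_iid A (E E' : (A -> R) -> R) L g : expectation E -> E =1 E' ->
  iid E L g = iid E' L g.
Proof.
move=> hE EE'; elim: L g => [|L IH] g //=.
by rewrite -EE'; apply: (eq_expect hE) => a.
Qed.

Lemma iid_prod A (E : (A -> R) -> R) L (h : A -> R) : expectation E ->
  iid E L (fun l => \prod_(a <- l) h a) = E h ^+ L.
Proof.
move=> hE; elim: L => [|L IH] /=; first by rewrite big_nil.
rewrite exprSr -IH -(expectZ hE); apply: (eq_expect hE) => a.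
rewrite mulrC -(expectZ (expectation_iid L hE)).
by apply: (eq_expect (expectation_iid L hE)) => l; rewrite big_cons.
Qed.

(** Squared mean plus variance. The offset [c] lets the induction absorb the first draw, and later
    serves to centre the statistic. *)
Lemma iid_sqr_sum A (E : (A -> R) -> R) L (g : A -> R) c : expectation E ->
  iid E L (fun l => (c + \sum_(a <- l) g a) ^+ 2) =
  (c + L%:R * E g) ^+ 2 + L%:R * (E (fun a => g a ^+ 2) - E g ^+ 2).
Proof.
move=> hE; elim: L c => [|L IH] c /=.
  by rewrite big_nil !mul0r !addr0.
rewrite (@eq_expect _ _ hE _ (fun a => g a ^+ 2 + (2 * (c + L%:R * E g) * g a
  + ((c + L%:R * E g) ^+ 2 + L%:R * (E (fun a => g a ^+ 2) - E g ^+ 2))))).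
  by rewrite !(expectD hE) (expectZ hE) !(expect_cst hE) -natr1; ring.
move=> a; rewrite (@eq_expect _ _ (expectation_iid L hE) _
  (fun l => (c + g a + \sum_(a <- l) g a) ^+ 2)).
  by rewrite IH; ring.
by move=> l; rewrite big_cons addrA.
Qed.

Definition majority (l : seq bool) : bool := (count negb l < count id l)%N.

Lemma majority_error (E : (bool -> R) -> R) L (v : bool) : expectation E ->
  E (fun a => (a != v)%:R) <= 10^-1 ->
  iid E L (fun l => (majority l != v)%:R) <= (3 / 5) ^+ L.
Proof.
move=> hE hv; have hI := expectation_iid L hE.
(* each wrong vote weighs 3 and each right one 1/3: a wrong majority has weight >= 1 *)
pose h (a : bool) : R := if a != v then 3 else 3^-1.
apply: (@le_trans _ _ (iid E L (fun l => \prod_(a <- l) h a))).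
  apply: (expect_le hI) => l.
  have -> : \prod_(a <- l) h a = 3 ^+ count (predC1 v) l * 3^-1 ^+ count (pred1 v) l.
    elim: l => [|a l IH] /=; first by rewrite big_nil !expr0 mulr1.
    rewrite big_cons IH /h; case: eqP => _ /=; rewrite ?add0n ?add1n ?exprS; ring.
  have p0 (i j : nat) : 0 <= 3 ^+ i * 3^-1 ^+ j :> R.
    by rewrite mulr_ge0 // exprn_ge0 // invr_ge0.
  have p1 (i j : nat) : (j <= i)%N -> 1 <= 3 ^+ i * 3^-1 ^+ j :> R.
    move=> ij; rewrite -(subnK ij) exprD exprVn mulfK ?expf_neq0 ?pnatr_eq0 //.
    by rewrite exprn_ege1 // ler1n.
  have [_|hm] := eqVneq (majority l) v; first exact: p0.
  (* A tie counts as [false]; when [v] is [true] it is an error of weight exactly 1, which [p1]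
     still covers. *)
  apply: p1; move: hm; rewrite /majority.
  have e1 : count (pred1 true) l = count id l by apply: eq_count; case.
  have e2 : count (pred1 false) l = count negb l by apply: eq_count; case.
  have e3 : count (predC1 true) l = count negb l by apply: eq_count; case.
  have e4 : count (predC1 false) l = count id l by apply: eq_count; case.
  case: v {h hv p0} => /=; rewrite ?e1 ?e2 ?e3 ?e4; case: ltnP => //.
  by move=> /ltnW.
rewrite iid_prod //; apply: lerXn2r.
- by rewrite nnegrE (expect_ge0 hE) // => a; rewrite /h; case: ifP => _; rewrite ?invr_ge0.
- by rewrite nnegrE divr_ge0.
(* The mean weight of a vote is at most [3^-1 + (3 - 3^-1) / 10 = 3 / 5]. *)
rewrite (@eq_expect _ _ hE _ (fun a => 3^-1 + (3 - 3^-1) * (a != v)%:R)).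
  rewrite (expectD hE) (expectZ hE) (expect_cst hE); lra.
by move=> a; rewrite /h; case: ifP => _ /=; rewrite ?mulr1 ?mulr0; ring.
Qed.

Definition dexp (T : finType) (p : T -> R) (g : T -> R) : R := \sum_x p x * g x.

Lemma expectation_dexp (T : finType) (p : T -> R) :
  (forall x, 0 <= p x) -> \sum_x p x = 1 -> expectation (dexp p).
Proof.
move=> p0 p1; rewrite /dexp; split.
- by move=> f g; rewrite -big_split; apply: eq_bigr => x _; rewrite mulrDr.
- by move=> c f; rewrite mulr_sumr; apply: eq_bigr => x _; rewrite mulrCA.
- by move=> f f0; apply: sumr_ge0 => x _; rewrite mulr_ge0.
- by rewrite -[RHS]p1; apply: eq_bigr => x _; rewrite mulr1.
Qed.

End Expectation.

(** * Inequalities for powers *)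

Section PowerInequalities.
Variable R : realType.
Implicit Types (x y p q : R) (t : nat).

Lemma bernoulli x t : -1 <= x -> 1 + t%:R * x <= (1 + x) ^+ t.
Proof.
move=> hx; elim: t => [|t IH]; first by rewrite expr0; lra.
rewrite exprS -natr1.
have h : 0 <= (1 + x) * ((1 + x) ^+ t - (1 + t%:R * x)).
  by rewrite mulr_ge0 ?subr_ge0 //; lra.
have h2 : 0 <= t%:R * x ^+ 2 by rewrite mulr_ge0 // sqr_ge0.
nra.
Qed.

(** The product [(1 - p) ^+ t * (1 + p) ^+ t] is a power of [1 - p ^+ 2]. This gives decay of
    [(1 - p) ^+ t] in [t * p] without exponentials. *)
Lemma expr1B_le p t : 0 <= p <= 1 -> (1 - p) ^+ t * (1 + t%:R * p) <= 1.
Proof.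
move=> /andP[p0 p1]; apply: (@le_trans _ _ ((1 - p) ^+ t * (1 + p) ^+ t)).
  rewrite ler_wpM2l ?exprn_ge0 ?subr_ge0 //; apply: bernoulli; lra.
rewrite -exprMn exprn_ile1 //; nra.
Qed.

Lemma subr_expr_le x y t : 0 <= y <= x ->
  x ^+ t - y ^+ t <= (x - y) * (t%:R * x ^+ t.-1).
Proof.
move=> /andP[y0 yx]; have x0 := le_trans y0 yx.
rewrite subrXX ler_wpM2l ?subr_ge0 //.
rewrite -[t in t%:R]card_ord mulr_natl -sumr_const; apply: ler_sum => i _.
have it : (i <= t.-1)%N by rewrite -ltnS (leq_trans (ltn_ord i)) // leqSpred.
by rewrite -{2}(subnK it) exprD ler_wpM2l ?exprn_ge0 ?lerXn2r.
Qed.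

Lemma subr_expr_ge x y t : 0 <= y <= x ->
  (x - y) * (t%:R * y ^+ t.-1) <= x ^+ t - y ^+ t.
Proof.
move=> /andP[y0 yx]; have x0 := le_trans y0 yx.
rewrite subrXX ler_wpM2l ?subr_ge0 //.
rewrite -[t in t%:R]card_ord mulr_natl -sumr_const; apply: ler_sum => i _.
have it : (i <= t.-1)%N by rewrite -ltnS (leq_trans (ltn_ord i)) // leqSpred.
by rewrite -{1}(subnK it) exprD ler_wpM2r ?exprn_ge0 ?lerXn2r.
Qed.

(** From [t] to [t.+1] both sides are multiplied by [1 - p] and then gain a term; the gain on the
    left, [(2 * t + 3) * p * (1 - p) ^+ t.+1], is at most the gain 2 on the right by [expr1B_le]. *)
Lemma geometric_sum_ge p t : 0 <= p <= 1 ->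
  t.+1%:R ^+ 2 * p * (1 - p) ^+ t <= 2 * \sum_(i < t.+1) (1 - p) ^+ i.
Proof.
move=> hp; have /andP[p0 p1] := hp; elim: t => [|t IH].
  by rewrite big_ord1 expr0; lra.
rewrite big_ord_recl expr0.
under eq_bigr => i _ do rewrite /= /bump add1n exprS.
rewrite -mulr_sumr [_ ^+ t.+1]exprS.
have h1 := expr1B_le t.+1 hp; rewrite exprS in h1.
set S := \sum_(i < _) _ in IH *; set u := (1 - p) ^+ t in IH h1 *.
have u0 : 0 <= u by rewrite exprn_ge0 // subr_ge0.
have h2 : (1 - p) * (t.+1%:R ^+ 2 * p * u) <= (1 - p) * (2 * S).
  by rewrite ler_wpM2l // subr_ge0.
have h3 : p * ((1 - p) * u) <= 2 * ((1 - p) * u).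
  rewrite ler_wpM2r ?mulr_ge0 ?subr_ge0 //; lra.
rewrite -[t.+2%:R]natr1; lra.
Qed.

(** * Hitting a point of mass [p], against a light point of mass [q], in [t] draws *)

Section HitGap.
Variables (p q : R) (t : nat).
Hypotheses (hp : 0 <= p <= 1) (q0 : 0 <= q) (tq : t%:R * q <= 2^-1) (t0 : (0 < t)%N).

Let gap : R := `|(1 - p) ^+ t - (1 - q) ^+ t|.

Let q1 : q <= 1.
Proof.
have t1 : 1 <= t%:R :> R by rewrite ler1n.
have h : q <= t%:R * q by rewrite ler_peMl.
move: tq h; lra.
Qed.

Let miss_ge : 2^-1 <= (1 - q) ^+ t.
Proof.
have qq := q1; have tqq := tq.
have : 1 + t%:R * (- q) <= (1 + (- q)) ^+ t by apply: bernoulli; lra.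
lra.
Qed.

Let misspred_ge : 2^-1 <= (1 - q) ^+ t.-1.
Proof.
have qq := q1; have qq0 := q0.
apply: le_trans miss_ge _; rewrite -{1}(prednK t0) exprS ler_piMl ?exprn_ge0 ?subr_ge0 //.
lra.
Qed.

Lemma hit_gap_le : gap <= t%:R * `|p - q|.
Proof.
have qq0 := q0; have qq1 := q1; have tqq := tq; have mq := miss_ge.
have /andP[p0 p1] := hp.
have key (x y : R) : 0 <= x <= 1 -> 0 <= y <= x ->
    `|x ^+ t - y ^+ t| <= t%:R * (x - y).
  move=> /andP[x0 x1] hy; have /andP[y0 yx] := hy.
  rewrite ger0_norm ?subr_ge0 ?lerXn2r //.
  apply: le_trans (subr_expr_le t hy) _; rewrite mulrC ler_wpM2r ?subr_ge0 //.
  by rewrite ler_piMr // exprn_ile1.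
rewrite /gap; have [pq|qp] := leP p q.
  have -> : `|p - q| = (1 - p) - (1 - q) by rewrite distrC ger0_norm ?subr_ge0 //; ring.
  by apply: key; lra.
have -> : `|p - q| = (1 - q) - (1 - p) by rewrite ger0_norm ?subr_ge0 1?ltW //; ring.
by rewrite distrC; apply: key; lra.
Qed.

Lemma hit_gap_le1 : gap <= 1.
Proof.
have qq0 := q0; have qq1 := q1; have tqq := tq; have mq := miss_ge.
have /andP[p0 p1] := hp.
have h (z : R) : 0 <= z <= 1 -> 0 <= (1 - z) ^+ t <= 1.
  by move=> hz; rewrite exprn_ge0 ?exprn_ile1 //; lra.
have /andP[a0 a1] := h p hp; have /andP[b0 b1] := h q ltac:(lra).
by rewrite /gap ler_norml; lra.
Qed.

Lemma hit_gap_ge_neg : p <= q -> t%:R * `|p - q| <= 2 * gap.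
Proof.
have qq0 := q0; have qq1 := q1; have tqq := tq; have mq := miss_ge.
have /andP[p0 p1] := hp.
move=> pq; rewrite distrC ger0_norm ?subr_ge0 //.
have h : 0 <= 1 - q <= 1 - p by lra.
have h1 := subr_expr_ge t h; have h2 := ler_norm ((1 - p) ^+ t - (1 - q) ^+ t).
rewrite -/gap in h2.
have h3 : (q - p) * (t%:R * 2^-1) <= (q - p) * (t%:R * (1 - q) ^+ t.-1).
  by rewrite ler_wpM2l ?subr_ge0 // ler_wpM2l.
have e : 1 - p - (1 - q) = q - p by ring.
rewrite e in h1; lra.
Qed.

(** The gap grows like [t * |p - q|] until it saturates at a constant; the factor [1 + t * |p - q|]
    expresses both regimes at once. For [p > q], [1 - p <= (1 - q) * (1 - (p - q))] reduces the
    bound to [expr1B_le]. *)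
Lemma hit_gap_ge : t%:R * `|p - q| <= 4 * gap * (1 + t%:R * `|p - q|).
Proof.
have qq0 := q0; have qq1 := q1; have tqq := tq; have mq := miss_ge.
have /andP[p0 p1] := hp; have g0 : 0 <= gap by apply: normr_ge0.
have d0 : 0 <= t%:R * `|p - q| by rewrite mulr_ge0.
have [pq|qp] := leP p q.
  have := hit_gap_ge_neg pq; have : 0 <= gap * (t%:R * `|p - q|) by rewrite mulr_ge0.
  lra.
have dE : `|p - q| = p - q by rewrite ger0_norm ?subr_ge0 1?ltW.
rewrite dE in d0 *; have hd : 0 <= p - q <= 1 by lra.
have h1 := expr1B_le t hd; set u := (1 - (p - q)) ^+ t in h1.
have h2 : (1 - p) ^+ t <= (1 - q) ^+ t * u.
  rewrite -exprMn lerXn2r ?nnegrE ?mulr_ge0 ?subr_ge0 //; nra.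
have h3 : (1 - q) ^+ t - (1 - p) ^+ t <= gap.
  by rewrite /gap distrC ler_norm.
have u0 : 0 <= u by rewrite exprn_ge0; lra.
have u1 : u <= 1 by rewrite exprn_ile1; lra.
have h4 : 2^-1 * (1 - u) <= gap.
  have : 0 <= ((1 - q) ^+ t - 2^-1) * (1 - u) by rewrite mulr_ge0 // subr_ge0.
  lra.
have : 2^-1 * (1 - u) * (1 + t%:R * (p - q)) <= gap * (1 + t%:R * (p - q)).
  by rewrite ler_wpM2r //; lra.
lra.
Qed.

(** [t * p * (1 - p) ^+ t.-1] is the chance that exactly one draw hits the point, and governs the
    variance of a block. A heavy point is usually hit repeatedly, which keeps this chance, even
    multiplied by [t * |p - q|], below a multiple of the gap. *)
Lemma single_hit_le :
  t%:R ^+ 2 * `|p - q| * p * (1 - p) ^+ t.-1 <= 4 * gap.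
Proof.
have qq0 := q0; have qq1 := q1; have tqq := tq; have mq := miss_ge.
have /andP[p0 p1] := hp; have g0 : 0 <= gap by apply: normr_ge0.
have u1 : (1 - p) ^+ t.-1 <= 1 by rewrite exprn_ile1; lra.
have [pq|qp] := leP p q.
  have h1 := hit_gap_ge_neg pq.
  apply: (@le_trans _ _ (t%:R * `|p - q| * (t%:R * q))); last first.
    have : t%:R * `|p - q| * (t%:R * q) <= t%:R * `|p - q| * 2^-1.
      by rewrite ler_wpM2l // mulr_ge0.
    lra.
  have -> : t%:R ^+ 2 * `|p - q| * p * (1 - p) ^+ t.-1 =
    t%:R * `|p - q| * (t%:R * (p * (1 - p) ^+ t.-1)) by ring.
  do 2 rewrite ler_wpM2l ?mulr_ge0 //.
  by apply: le_trans pq; rewrite ler_piMr.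
have dE : `|p - q| = p - q by rewrite ger0_norm ?subr_ge0 1?ltW.
rewrite dE; have d0 : 0 <= p - q by lra.
have h3 : (1 - q) ^+ t - (1 - p) ^+ t <= gap by rewrite /gap distrC ler_norm.
have := geometric_sum_ge t.-1 hp; rewrite (prednK t0) => h4.
(* Each term of the factorisation of [(1 - q) ^+ t - (1 - p) ^+ t] keeps at least half of
   [(1 - p) ^+ i], by [misspred_ge]. *)
have h5 : (p - q) * (2^-1 * \sum_(i < t) (1 - p) ^+ i) <= (1 - q) ^+ t - (1 - p) ^+ t.
  rewrite subrXX.
  have -> : 1 - q - (1 - p) = p - q by ring.
  rewrite ler_wpM2l // mulr_sumr; apply: ler_sum => i _.
  rewrite ler_wpM2r ?exprn_ge0 ?subr_ge0 //.
  have it : (i <= t.-1)%N by rewrite -ltnS (leq_trans (ltn_ord i)) // leqSpred.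
  apply: le_trans misspred_ge _; rewrite -{1}(subnK it) exprD ler_piMr ?exprn_ge0 ?subr_ge0 //.
  by rewrite exprn_ile1; lra.
have : (p - q) * (t%:R ^+ 2 * p * (1 - p) ^+ t.-1) <=
       (p - q) * (2 * \sum_(i < t) (1 - p) ^+ i) by rewrite ler_wpM2l.
lra.
Qed.

End HitGap.
End PowerInequalities.

(** * Distinct values in a block of samples *)

Section Blocks.
Variables (R : realType) (T : finType) (P : T -> R) (t : nat).
Hypotheses (P0 : forall x, 0 <= P x) (P1 : \sum_x P x = 1).

Let hB : expectation (iid (dexp P) t) := expectation_iid t (expectation_dexp P0 P1).

Lemma dist_le1 x : P x <= 1.
Proof. by rewrite -P1 (bigD1 x) //= lerDl sumr_ge0. Qed.

Lemma block_avoid (p : pred T) :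
  iid (dexp P) t (fun B => (all p B)%:R) = (\sum_(x | p x) P x) ^+ t.
Proof.
have -> : \sum_(x | p x) P x = dexp P (fun x => (p x)%:R).
  rewrite /dexp big_mkcond; apply: eq_bigr => x _.
  by case: (p x); rewrite ?mulr1 ?mulr0.
rewrite -(iid_prod t _ (expectation_dexp P0 P1)); apply: (eq_expect hB) => B.
elim: B => [|x B IH] /=; first by rewrite big_nil.
by rewrite big_cons -IH; case: (p x); rewrite ?mul1r ?mul0r.
Qed.

Lemma block_miss x : iid (dexp P) t (fun B => (x \notin B)%:R) = (1 - P x) ^+ t.
Proof.
have -> : 1 - P x = \sum_(y | y != x) P y by rewrite -P1 (bigD1 x) //=; ring.
rewrite -block_avoid; apply: (eq_expect hB) => B.
congr (nat_of_bool _)%:R; rewrite -has_pred1 -all_predC.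
by apply: eq_all => y.
Qed.

Lemma block_miss2 x y : x != y ->
  iid (dexp P) t (fun B => (x \notin B)%:R * (y \notin B)%:R) = (1 - P x - P y) ^+ t.
Proof.
move=> xy; have -> : 1 - P x - P y = \sum_(z | (z != x) && (z != y)) P z.
  by rewrite -P1 (bigD1 x) //= (bigD1 y) 1?eq_sym //=; ring.
rewrite -block_avoid; apply: (eq_expect hB) => B.
rewrite -natrM mulnb; congr (nat_of_bool _)%:R.
elim: B => [|z B IH] //=; rewrite -IH !inE !negb_or (eq_sym x) (eq_sym y).
by case: (z == x); case: (z == y); rewrite //= andbF.
Qed.

Lemma block_hit x : iid (dexp P) t (fun B => (x \in B)%:R) = 1 - (1 - P x) ^+ t.
Proof.
rewrite -block_miss -[X in X - _](expect1 hB) -(expectB hB).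
by apply: (eq_expect hB) => B; case: (x \in B); rewrite /= ?subr0 ?subrr.
Qed.

(** On the diagonal this is a Bernoulli variance. Off it, [(1 - P x - P y) ^+ t] is compared with
    [((1 - P x) * (1 - P y)) ^+ t], whose bases differ by [P x * P y] only. *)
Lemma block_cov x y :
  `|iid (dexp P) t (fun B => ((1 - P x) ^+ t - (x \notin B)%:R) *
                             ((1 - P y) ^+ t - (y \notin B)%:R))| <=
  (x == y)%:R * (t%:R * (P x * (1 - P x) ^+ t.-1)) +
  t%:R * (P x * (1 - P x) ^+ t.-1) * (P y * (1 - P y) ^+ t.-1).
Proof.
have q0 z : 0 <= 1 - P z by rewrite subr_ge0 dist_le1.
have q1 z : 1 - P z <= 1 by rewrite gerBl.
set w := fun z => (1 - P z) ^+ t.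
have -> : iid (dexp P) t (fun B => (w x - (x \notin B)%:R) * (w y - (y \notin B)%:R)) =
  iid (dexp P) t (fun B => (x \notin B)%:R * (y \notin B)%:R) - w x * w y.
  rewrite (@eq_expect _ _ _ hB _ (fun B => (x \notin B)%:R * (y \notin B)%:R +
    (- w y * (x \notin B)%:R + (- w x * (y \notin B)%:R + w x * w y)))).
    by rewrite !(expectD hB) !(expectZ hB) (expect_cst hB) !block_miss -/(w x) -/(w y); ring.
  by move=> B; ring.
have [<-|xy] := eqVneq x y.
  rewrite (@eq_expect _ _ _ hB _ (fun B => (x \notin B)%:R)); last first.
    by move=> B; case: (x \notin B); rewrite ?mulr1 ?mulr0.
  rewrite block_miss -/(w x) mul1r.
  have w0 : 0 <= w x by rewrite exprn_ge0.
  have w1 : w x <= 1 by rewrite exprn_ile1.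
  rewrite ger0_norm; last by rewrite -[X in X - _]mulr1 -mulrBr mulr_ge0 // subr_ge0.
  apply: (@le_trans _ _ (t%:R * (P x * (1 - P x) ^+ t.-1))); last first.
    by rewrite lerDl !mulr_ge0 ?exprn_ge0.
  have h1 : 1 - w x <= t%:R * P x.
    have : 1 + t%:R * (- P x) <= (1 + - P x) ^+ t.
      by apply: bernoulli; rewrite lerN2 dist_le1.
    rewrite -/(w x); lra.
  have h2 : w x <= (1 - P x) ^+ t.-1.
    rewrite /w; case: (t) => // t'; rewrite exprS ler_piMl ?exprn_ge0 //.
  apply: (@le_trans _ _ (w x * (t%:R * P x))).
    by rewrite -[X in X - _]mulr1 -mulrBr ler_wpM2l.
  by rewrite mulrC -mulrA ler_wpM2l // ler_wpM2l.
rewrite mul0r add0r block_miss2 // /w -exprMn distrC.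
have hs : P x + P y <= 1.
  by rewrite -P1 (bigD1 x) //= lerD2l (bigD1 y) 1?eq_sym //= lerDl sumr_ge0.
have h : 0 <= 1 - P x - P y <= (1 - P x) * (1 - P y).
  have : 0 <= P x * P y by rewrite mulr_ge0.
  by move: (hs); lra.
have /andP[h1 h2] := h.
rewrite ger0_norm ?subr_ge0 ?lerXn2r ?nnegrE ?mulr_ge0 //.
apply: le_trans (subr_expr_le t h) _; rewrite exprMn.
by rewrite le_eqVlt; apply/orP; left; apply/eqP; ring.
Qed.

(** The diagonal gives [t] times the sum once; the off-diagonal terms are at most [t] times the
    square of a [P]-mean, which Jensen bounds by the same sum. *)
Lemma block_variance (d : T -> R) :
  iid (dexp P) t (fun B => (\sum_x d x * ((x \in B)%:R - (1 - (1 - P x) ^+ t))) ^+ 2) <=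
  2 * (t%:R * \sum_x d x ^+ 2 * (P x * (1 - P x) ^+ t.-1)).
Proof.
pose u (x : T) (B : seq T) : R := (1 - P x) ^+ t - (x \notin B)%:R.
rewrite (@eq_expect _ _ _ hB _ (fun B => \sum_x \sum_y (d x * d y) * (u x B * u y B))); last first.
  move=> B; rewrite expr2 big_distrlr /=; apply: eq_bigr => x _; apply: eq_bigr => y _.
  have e z : (z \in B)%:R - (1 - (1 - P z) ^+ t) = u z B.
    by rewrite /u; case: (z \in B) => /=; ring.
  by rewrite !e; ring.
rewrite (expect_sum hB).
under eq_bigr => x _.
  rewrite (expect_sum hB); under eq_bigr => y _ do rewrite (expectZ hB).
  over.
pose v x := P x * (1 - P x) ^+ t.-1.
have q0 z : 0 <= 1 - P z by rewrite subr_ge0 dist_le1.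
have q1 z : 1 - P z <= 1 by rewrite gerBl.
have v0 x : 0 <= v x by rewrite mulr_ge0 ?exprn_ge0.
apply: (@le_trans _ _ (\sum_x (t%:R * (d x ^+ 2 * v x) +
    t%:R * (`|d x| * v x) * \sum_y (`|d y| * v y)))).
  apply: ler_sum => x _.
  have -> : t%:R * (d x ^+ 2 * v x) =
      \sum_y (x == y)%:R * (t%:R * (`|d x| * `|d y| * v x)).
    rewrite (bigD1 x) //= eqxx big1 ?addr0 => [|y yx]; last first.
      by rewrite eq_sym (negbTE yx) mul0r.
    by rewrite mul1r -expr2 real_normK ?num_real.
  rewrite mulr_sumr -big_split; apply: ler_sum => y _ /=.
  apply: le_trans (ler_norm _) _; rewrite normrM normrM.
  apply: le_trans (ler_wpM2l _ (block_cov x y)) _; first by rewrite mulr_ge0.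
  by rewrite -/(v x) -/(v y) le_eqVlt; apply/orP; left; apply/eqP; ring.
rewrite big_split /= -mulr_sumr -mulr_suml -mulr_sumr.
set S := \sum_x d x ^+ 2 * v x; set A := \sum_y `|d y| * v y.
have AS : A ^+ 2 <= S.
  have hA : A = dexp P (fun x => `|d x| * (1 - P x) ^+ t.-1).
    by apply: eq_bigr => x _; rewrite /v; ring.
  rewrite hA; apply: le_trans (sqr_expect_le (expectation_dexp P0 P1) _) _.
  apply: ler_sum => x _; rewrite exprMn real_normK ?num_real //.
  rewrite /v mulrCA ler_wpM2l ?sqr_ge0 // ler_wpM2l //.
  by rewrite expr2 ler_piMl ?exprn_ge0 ?exprn_ile1.
have : t%:R * A ^+ 2 <= t%:R * S by rewrite ler_wpM2l.
rewrite expr2; lra.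
Qed.

End Blocks.

(** * The test statistic *)

Lemma l1_dist_le2 (R : realType) (T : finType) (P Q : T -> R) :
  (forall x, 0 <= P x) -> \sum_x P x = 1 -> (forall x, 0 <= Q x) -> \sum_x Q x = 1 ->
  \sum_x `|P x - Q x| <= 2.
Proof.
move=> P0 P1 Q0 Q1.
apply: (@le_trans _ _ (\sum_x (P x + Q x))); last by rewrite big_split P1 Q1.
apply: ler_sum => x _; apply: le_trans (ler_normB _ _) _.
by rewrite !ger0_norm.
Qed.

Section TestStatistic.
Variables (R : realType) (T : finType) (Q : T -> R) (n t b m : nat).

Definition weight (Xs : seq (seq T)) (x : T) : R :=
  (\sum_(B <- Xs) ((x \in B)%:R - (1 - (1 - Q x) ^+ t))) / b%:R.

Definition excess (Xs : seq (seq T)) (Y : seq T) : R :=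
  (\sum_(y <- Y) weight Xs y) / m%:R - dexp Q (weight Xs).

(** For [Y] from [Q] the second moment of [excess] is at most the [Q]-energy of [weight] over [m],
    and the factor 10 is the Chebyshev loss for error [10^-1]. The second term has the order of the
    sampling noise in [weight] and keeps the threshold positive. *)
Definition threshold (Xs : seq (seq T)) : R :=
  10 * (dexp Q (fun x => weight Xs x ^+ 2) + t%:R / (n%:R * b%:R)).

Definition fires (Xs : seq (seq T)) (Y : seq T) : bool :=
  threshold Xs < m%:R * excess Xs Y ^+ 2.

Hypotheses (n0 : (0 < n)%N) (t0 : (0 < t)%N) (b0 : (0 < b)%N) (m0 : (0 < m)%N).

Lemma threshold_gt0 Xs : (forall x, 0 <= Q x) -> 0 < threshold Xs.
Proof.
move=> Q0; rewrite mulr_gt0 // ltr_wpDl ?divr_gt0 ?mulr_gt0 ?ltr0n //.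
by apply: sumr_ge0 => x _; rewrite mulr_ge0 ?sqr_ge0.
Qed.

Lemma excess_sqr_mean (P : T -> R) Xs c :
  (forall x, 0 <= P x) -> \sum_x P x = 1 ->
  iid (dexp P) m (fun Y => (excess Xs Y - c) ^+ 2) <=
  (dexp P (weight Xs) - dexp Q (weight Xs) - c) ^+ 2 +
  dexp P (fun x => weight Xs x ^+ 2) / m%:R.
Proof.
move=> P0 P1; have hP := expectation_dexp P0 P1.
have mr : m%:R != 0 :> R by rewrite pnatr_eq0 -lt0n.
rewrite (@eq_expect _ _ _ (expectation_iid m hP) _ (fun Y =>
  (- dexp Q (weight Xs) - c + \sum_(y <- Y) m%:R^-1 * weight Xs y) ^+ 2)); last first.
  by move=> Y; rewrite /excess -mulr_sumr mulrC; congr (_ ^+ 2); ring.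
rewrite (iid_sqr_sum _ _ _ hP) (expectZ hP).
rewrite (@eq_expect _ _ _ hP (fun a => (m%:R^-1 * weight Xs a) ^+ 2)
  (fun a => m%:R^-1 ^+ 2 * weight Xs a ^+ 2)); last by move=> a; rewrite exprMn.
rewrite (expectZ hP).
set p := dexp P _; set q := dexp Q _; set V := dexp P _.
have -> : - q - c + m%:R * (m%:R^-1 * p) = p - q - c by field.
have -> : m%:R * (m%:R^-1 ^+ 2 * V - (m%:R^-1 * p) ^+ 2) = V / m%:R - p ^+ 2 / m%:R.
  by field.
by rewrite lerD2l gerBl divr_ge0 // sqr_ge0.
Qed.

(** Chebyshev, uniformly in [Xs]; this is what later lets one reference serve all indices. *)
Lemma fires_null Xs : (forall x, 0 <= Q x) -> \sum_x Q x = 1 ->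
  iid (dexp Q) m (fun Y => (fires Xs Y)%:R) <= 10^-1.
Proof.
move=> Q0 Q1; have hQ := expectation_dexp Q0 Q1; have hI := expectation_iid m hQ.
have h0 := threshold_gt0 Xs Q0; have mr : 0 < m%:R :> R by rewrite ltr0n.
apply: (@le_trans _ _ (iid (dexp Q) m
    (fun Y => (m%:R / threshold Xs) * (excess Xs Y - 0) ^+ 2))).
  apply: (expect_le hI) => Y; rewrite subr0 /fires.
  case: ltP => h /=; last by rewrite mulr_ge0 ?sqr_ge0 ?divr_ge0 // ltW.
  by rewrite mulrAC ler_pdivlMr // mul1r ltW.
rewrite (expectZ hI); have := excess_sqr_mean Xs 0 Q0 Q1.
rewrite subrr subr0 expr0n add0r => h.
apply: le_trans (ler_wpM2l _ h) _; first by rewrite divr_ge0 // ltW.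
set V := dexp Q _.
have -> : m%:R / threshold Xs * (V / m%:R) = V / threshold Xs.
  by field; rewrite !gt_eqF.
rewrite ler_pdivrMr // /threshold -/V mulrA mulVf ?pnatr_eq0 // mul1r.
by rewrite lerDl divr_ge0 // mulr_ge0.
Qed.

(** * Moments of the statistic when the reference comes from [P] *)

Section Alternative.
Variable P : T -> R.
Hypotheses (P0 : forall x, 0 <= P x) (P1 : \sum_x P x = 1).
Hypotheses (Q0 : forall x, 0 <= Q x) (Q1 : \sum_x Q x = 1).
Hypotheses (Qle : forall x, Q x <= (2 * n%:R)^-1) (tn : (t <= n)%N).

Let gap (x : T) : R := `|(1 - P x) ^+ t - (1 - Q x) ^+ t|.
(** The mean, over references drawn from [P], of the [P]-mean minus the [Q]-mean of [weight]. *)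
Definition signal : R := \sum_x `|P x - Q x| * gap x.

Let hP := expectation_dexp P0 P1.
Let hB := expectation_iid t hP.
Let hX := expectation_iid b hB.
Let Pb x : 0 <= P x <= 1.
Proof. by rewrite P0 dist_le1. Qed.

Let nr : 0 < n%:R :> R. Proof. by rewrite ltr0n. Qed.
Let br : 0 < b%:R :> R. Proof. by rewrite ltr0n. Qed.

Let tQ x : t%:R * Q x <= 2^-1.
Proof.
apply: (@le_trans _ _ (n%:R * (2 * n%:R)^-1)).
  by rewrite ler_pM ?ler_nat.
by rewrite invfM mulrCA divff ?mulr1 // gt_eqF.
Qed.

Let gap0 x : 0 <= gap x. Proof. exact: normr_ge0. Qed.
Let signal0 : 0 <= signal.
Proof. by apply: sumr_ge0 => x _; rewrite mulr_ge0. Qed.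

(** The distribution with the larger mass at [x] also hits [x] more often, so the contributions of
    different points never cancel. *)
Let signed x : (P x - Q x) * ((1 - Q x) ^+ t - (1 - P x) ^+ t) = `|P x - Q x| * gap x.
Proof.
rewrite /gap [`|_ - (1 - Q x) ^+ t|]distrC -normrM ger0_norm //.
have p1 : 0 <= 1 - P x by rewrite subr_ge0 dist_le1.
have q1 : 0 <= 1 - Q x by rewrite subr_ge0 dist_le1.
have [pq|qp] := leP (P x) (Q x).
  rewrite -mulrNN !opprB mulr_ge0 ?subr_ge0 // lerXn2r ?nnegrE //.
  by rewrite lerD2l lerN2.
rewrite mulr_ge0 ?subr_ge0 ?(ltW qp) // lerXn2r ?nnegrE //.
by rewrite lerD2l lerN2 ltW.
Qed.

Let hit x : iid (dexp P) t (fun B => (x \in B)%:R - (1 - (1 - Q x) ^+ t)) =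
  (1 - Q x) ^+ t - (1 - P x) ^+ t.
Proof. by rewrite (expectB hB) (expect_cst hB) block_hit //; ring. Qed.

Lemma weight_sqr_mean x :
  iid (iid (dexp P) t) b (fun Xs => weight Xs x ^+ 2) <=
  gap x ^+ 2 + (1 - (1 - P x) ^+ t) / b%:R.
Proof.
have b1 : b%:R != 0 :> R by rewrite gt_eqF.
pose g (B : seq T) := (x \in B)%:R - (1 - (1 - Q x) ^+ t).
rewrite (@eq_expect _ _ _ hX _
  (fun Xs => (0 + \sum_(B <- Xs) b%:R^-1 * g B) ^+ 2)); last first.
  by move=> Xs; rewrite /weight -mulr_sumr add0r mulrC.
rewrite (iid_sqr_sum _ _ _ hB) (expectZ hB) hit.
rewrite (@eq_expect _ _ _ hB (fun B => (b%:R^-1 * g B) ^+ 2)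
  (fun B => b%:R^-1 ^+ 2 * ((1 - 2 * (1 - (1 - Q x) ^+ t)) * (x \in B)%:R
     + (1 - (1 - Q x) ^+ t) ^+ 2))); last first.
  by move=> B; rewrite exprMn /g; case: (x \in B) => /=; ring.
rewrite (expectZ hB) (expectD hB) (expectZ hB) (expect_cst hB) block_hit //.
rewrite /gap real_normK ?num_real //.
set u := (1 - Q x) ^+ t; set v := (1 - P x) ^+ t.
have -> : (0 + b%:R * (b%:R^-1 * (u - v))) ^+ 2 +
   b%:R * (b%:R^-1 ^+ 2 * ((1 - 2 * (1 - u)) * (1 - v) + (1 - u) ^+ 2) -
     (b%:R^-1 * (u - v)) ^+ 2) = (v - u) ^+ 2 + (1 - v) / b%:R - (1 - v) ^+ 2 / b%:R.
  by field.
by rewrite gerBl divr_ge0 ?sqr_ge0.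
Qed.

(** One factor of [gap x ^+ 2] is spent as [t * |P x - Q x|] and [Q x] as [1 / (2 * n)], which
    leaves the signal; the noise is summed by [1 - (1 - P x) ^+ t <= t * P x]. *)
Lemma weight_null_energy :
  iid (iid (dexp P) t) b (fun Xs => dexp Q (fun x => weight Xs x ^+ 2)) <=
  t%:R / (2 * n%:R) * signal + t%:R / (2 * n%:R) / b%:R.
Proof.
rewrite /dexp (expect_sum hX).
apply: (@le_trans _ _ (\sum_x (t%:R / (2 * n%:R) * (`|P x - Q x| * gap x) +
    t%:R / (2 * n%:R) / b%:R * P x))); last first.
  by rewrite big_split /= -!mulr_sumr P1 mulr1.
apply: ler_sum => x _; rewrite (expectZ hX).
apply: le_trans (ler_wpM2l (Q0 x) (weight_sqr_mean x)) _.
rewrite mulrDr lerD //.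
  apply: (@le_trans _ _ ((2 * n%:R)^-1 * (t%:R * `|P x - Q x| * gap x))).
    rewrite ler_pM ?sqr_ge0 // expr2 ler_wpM2r //.
    exact: hit_gap_le.
  by rewrite le_eqVlt; apply/orP; left; apply/eqP; ring.
have h1 : 1 - (1 - P x) ^+ t <= t%:R * P x.
  have := bernoulli t (x := - P x); rewrite lerN2 dist_le1 // => /(_ isT); lra.
apply: (@le_trans _ _ ((2 * n%:R)^-1 * (t%:R * P x / b%:R))).
  rewrite ler_pM ?divr_ge0 // ?ler_wpM2r ?invr_ge0 //.
  by rewrite subr_ge0 exprn_ile1 // ?subr_ge0 ?dist_le1 // gerBl.
by rewrite le_eqVlt; apply/orP; left; apply/eqP; ring.
Qed.

(** [P] is replaced by [Q + |P - Q|]. In the second part [gap x <= 1], so up to the noise term a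
    heavy point of [P] costs only a multiple of its own share of the signal. *)
Lemma weight_alternative_energy :
  iid (iid (dexp P) t) b (fun Xs => dexp P (fun x => weight Xs x ^+ 2)) <=
  3 * signal + 2 * (t%:R / (n%:R * b%:R)).
Proof.
have tn1 : t%:R / (2 * n%:R) <= 2^-1 :> R.
  by rewrite ler_pdivrMr ?mulr_gt0 // mulrA mulVf ?pnatr_eq0 // mul1r ler_nat.
have d2 : \sum_x `|P x - Q x| <= 2 by apply: l1_dist_le2.
apply: (@le_trans _ _ (iid (iid (dexp P) t) b (fun Xs =>
   dexp Q (fun x => weight Xs x ^+ 2) +
   \sum_x `|P x - Q x| * weight Xs x ^+ 2))).
  apply: (expect_le hX) => Xs; rewrite /dexp -big_split; apply: ler_sum => x _ /=.
  rewrite -mulrDl ler_wpM2r ?sqr_ge0 // -lerBlDl; exact: ler_norm.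
rewrite (expectD hX) [X in _ + X](expect_sum hX).
have h2 : \sum_x iid (iid (dexp P) t) b (fun Xs => `|P x - Q x| * weight Xs x ^+ 2) <=
   2 * signal + t%:R / (n%:R * b%:R).
  apply: (@le_trans _ _ (\sum_x (2 * (`|P x - Q x| * gap x) +
      t%:R / (2 * n%:R * b%:R) * `|P x - Q x|))); last first.
    rewrite big_split /= -!mulr_sumr lerD2l.
    apply: le_trans (ler_wpM2l _ d2) _; first by rewrite divr_ge0 ?mulr_ge0.
    rewrite le_eqVlt; apply/orP; left; apply/eqP; field.
    by rewrite !gt_eqF.
  apply: ler_sum => x _; rewrite (expectZ hX).
  apply: le_trans (ler_wpM2l (normr_ge0 _) (weight_sqr_mean x)) _.
  have g1 : gap x <= 1 by apply: hit_gap_le1.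
  have h1 : 1 - (1 - P x) ^+ t <= t%:R / (2 * n%:R) + gap x.
    have q1 : 1 - (1 - Q x) ^+ t <= t%:R / (2 * n%:R).
      have := bernoulli t (x := - Q x); rewrite lerN2 dist_le1 // => /(_ isT).
      have : t%:R * Q x <= t%:R / (2 * n%:R) by rewrite ler_wpM2l.
      lra.
    have := ler_norm ((1 - Q x) ^+ t - (1 - P x) ^+ t); rewrite distrC -/(gap x); lra.
  have -> : 2 * (`|P x - Q x| * gap x) + t%:R / (2 * n%:R * b%:R) * `|P x - Q x| =
    `|P x - Q x| * (gap x + (t%:R / (2 * n%:R) / b%:R + gap x)).
    by field; rewrite !gt_eqF.
  rewrite ler_wpM2l // lerD //; first by rewrite expr2 ler_piMl.
  have b1 : 1 <= b%:R :> R by rewrite ler1n.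
  apply: (@le_trans _ _ ((t%:R / (2 * n%:R) + gap x) / b%:R)).
    by rewrite ler_wpM2r // invr_ge0.
  by rewrite mulrDl lerD2l ler_pdivrMr // ler_peMr.
apply: le_trans (lerD weight_null_energy h2) _.
have : t%:R / (2 * n%:R) * signal <= 2^-1 * signal by rewrite ler_wpM2r.
have -> : t%:R / (2 * n%:R) / b%:R = 2^-1 * (t%:R / (n%:R * b%:R)) :> R.
  by field; rewrite !gt_eqF.
have s0 := signal0; have : 0 <= t%:R / (n%:R * b%:R) :> R by rewrite divr_ge0 ?mulr_ge0.
lra.
Qed.

(** The blocks are independent, so the statistic [G] of one block decides. Its variance follows from
    [block_variance] with [d = P - Q], and [single_hit_le] turns each summand into a summand of the
    signal. *)
Lemma weight_signal_variance :
  iid (iid (dexp P) t) b (fun Xs =>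
    (dexp P (weight Xs) - dexp Q (weight Xs) - signal) ^+ 2) <=
  8 * signal / (b%:R * t%:R).
Proof.
have b1 : b%:R != 0 :> R by rewrite gt_eqF.
have tr : t%:R != 0 :> R by rewrite pnatr_eq0 -lt0n.
pose G (B : seq T) := \sum_x (P x - Q x) * ((x \in B)%:R - (1 - (1 - Q x) ^+ t)).
have EG : iid (dexp P) t G = signal.
  rewrite /G (expect_sum hB); apply: eq_bigr => x _.
  by rewrite (expectZ hB) hit signed.
rewrite (@eq_expect _ _ _ hX _
  (fun Xs => (- signal + \sum_(B <- Xs) b%:R^-1 * G B) ^+ 2)); last first.
  move=> Xs; congr (_ ^+ 2); rewrite addrC; congr (_ + _).
  rewrite /dexp -sumrB -mulr_sumr /G exchange_big /= mulr_sumr.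
  apply: eq_bigr => x _; rewrite -mulrBl /weight -mulr_sumr; ring.
rewrite (iid_sqr_sum _ _ _ hB) (expectZ hB) EG.
rewrite (@eq_expect _ _ _ hB (fun B => (b%:R^-1 * G B) ^+ 2)
  (fun B => b%:R^-1 ^+ 2 * ((G B - signal) ^+ 2 + (2 * signal * G B + - signal ^+ 2)))); last first.
  by move=> B; ring.
rewrite (expectZ hB) (expectD hB) (expectD hB) (expectZ hB) (expect_cst hB) EG.
set V := iid _ _ _.
have -> : (- signal + b%:R * (b%:R^-1 * signal)) ^+ 2 +
  b%:R * (b%:R^-1 ^+ 2 * (V + (2 * signal * signal + - signal ^+ 2)) -
    (b%:R^-1 * signal) ^+ 2) = V / b%:R by field.
suff hV : V <= 8 * signal / t%:R.
  have -> : 8 * signal / (b%:R * t%:R) = 8 * signal / t%:R / b%:R by field; rewrite b1.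
  by rewrite ler_wpM2r ?invr_ge0.
have -> : V = iid (dexp P) t (fun B =>
    (\sum_x (P x - Q x) * ((x \in B)%:R - (1 - (1 - P x) ^+ t))) ^+ 2).
  apply: (eq_expect hB) => B; congr (_ ^+ 2); rewrite /G /signal -sumrB.
  by apply: eq_bigr => x _; rewrite -signed; ring.
apply: le_trans (block_variance t P0 P1 _) _.
rewrite ler_pdivlMr ?ltr0n // /signal !mulr_sumr mulr_suml; apply: ler_sum => x _.
have h := single_hit_le (Pb x) (Q0 x) (tQ x) t0.
rewrite -[(P x - Q x) ^+ 2]real_normK ?num_real //.
have -> : 2 * (t%:R * (`|P x - Q x| ^+ 2 * (P x * (1 - P x) ^+ t.-1))) * t%:R =
  2 * `|P x - Q x| * (t%:R ^+ 2 * `|P x - Q x| * P x * (1 - P x) ^+ t.-1) by ring.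
apply: le_trans (ler_wpM2l _ h) _; first by rewrite mulr_ge0.
by rewrite le_eqVlt -/(gap x); apply/orP; left; apply/eqP; ring.
Qed.

(* Failing to fire forces [(excess - signal)^2 + threshold / m >= signal^2 / 4]. *)
Lemma fires_alternative :
  0 < signal ->
  8 * 40 ^+ 2 <= b%:R * t%:R * signal ->
  3 * 40 ^+ 2 <= m%:R * signal ->
  5 * 40 ^+ 2 * (t%:R / n%:R) <= m%:R * signal ->
  17 * 40 ^+ 2 * (t%:R / (n%:R * b%:R)) <= m%:R * signal ^+ 2 ->
  iid (iid (dexp P) t) b (fun Xs =>
    iid (dexp P) m (fun Y => (~~ fires Xs Y)%:R)) <= (10 ^+ 2)^-1.
Proof.
move=> s0 H1 H2 H3 H4.
have mr : 0 < m%:R :> R by rewrite ltr0n.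
have hY := expectation_iid m hP.
have c0 : 0 <= 4 / signal ^+ 2 by rewrite divr_ge0 ?sqr_ge0.
apply: (@le_trans _ _ (iid (iid (dexp P) t) b (fun Xs => 4 / signal ^+ 2 *
   (((dexp P (weight Xs) - dexp Q (weight Xs) - signal) ^+ 2 +
     m%:R^-1 * dexp P (fun x => weight Xs x ^+ 2)) + m%:R^-1 * threshold Xs)))).
  apply: (expect_le hX) => Xs.
  apply: (@le_trans _ _ (iid (dexp P) m (fun Y => 4 / signal ^+ 2 *
     ((excess Xs Y - signal) ^+ 2 + m%:R^-1 * threshold Xs)))).
    apply: (expect_le hY) => Y; rewrite /fires -leNgt.
    have h0 := threshold_gt0 Xs Q0.
    have [h|h] := leP (m%:R * excess Xs Y ^+ 2) (threshold Xs); last first.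
      by rewrite mulr_ge0 // addr_ge0 ?sqr_ge0 // mulr_ge0 ?invr_ge0 ?ltW.
    rewrite mulrAC ler_pdivlMr ?exprn_gt0 // mul1r.
    have h1 : excess Xs Y ^+ 2 <= m%:R^-1 * threshold Xs.
      by rewrite mulrC ler_pdivlMr // mulrC.
    have := sqr_ge0 (2 * excess Xs Y - signal); move: h1; nra.
  rewrite (expectZ hY) ler_wpM2l // (expectD hY) (expect_cst hY) lerD2r.
  by apply: le_trans (excess_sqr_mean Xs signal P0 P1) _; rewrite [_ / m%:R]mulrC.
rewrite (expectZ hX) !(expectD hX) !(expectZ hX) (expectD hX) (expect_cst hX).
have e1 := weight_signal_variance; have e2 := weight_alternative_energy.
have e3 := weight_null_energy.
set X1 := iid _ _ _ in e1 *; set X2 := iid _ _ _ in e2 *; set X3 := iid _ _ _ in e3 *.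
set S := signal in s0 H1 H2 H3 H4 e1 e2 e3 *.
have bt0 : 0 < b%:R * t%:R :> R by rewrite mulr_gt0 // ltr0n.
have S2 : 0 < S ^+ 2 by rewrite exprn_gt0.
set h := t%:R / (n%:R * b%:R) in H4 e2 e3 *.
have e3' : X3 <= 2^-1 * (t%:R / n%:R * S) + 2^-1 * h.
  apply: le_trans e3 _; rewrite le_eqVlt; apply/orP; left; apply/eqP.
  by rewrite /h; field; rewrite !gt_eqF.
(* [X1] and the energy terms get 1 and 3 shares of [S ^+ 2 / 40 ^+ 2], and [4 * (1 + 3) / 40 ^+ 2]
   is the claimed [1 / 100]. *)
have A1 : 40 ^+ 2 * X1 <= S ^+ 2.
  apply: (@le_trans _ _ (40 ^+ 2 * (8 * S / (b%:R * t%:R)))).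
    by rewrite ler_wpM2l // exprn_ge0.
  rewrite mulrA ler_pdivrMr //.
  have := ler_wpM2r (ltW s0) H1; lra.
have A2 : 40 ^+ 2 * (3 * S) <= m%:R * S ^+ 2.
  have := ler_wpM2r (ltW s0) H2; lra.
have A3 : 40 ^+ 2 * (5 * (t%:R / n%:R * S)) <= m%:R * S ^+ 2.
  have := ler_wpM2r (ltW s0) H3; lra.
(* The energies add up to at most [3 * S + 5 * (t / n) * S + 17 * h], which is where the
   coefficients 3, 5 and 17 of the hypotheses come from. *)
have A4 : 40 ^+ 2 * (m%:R^-1 * (X2 + 10 * (X3 + h))) <= 3 * S ^+ 2.
  rewrite mulrCA mulrC ler_pdivrMr //; lra.
rewrite mulrAC ler_pdivrMr //; lra.
Qed.

End Alternative.
End TestStatistic.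

(** * Power of the test *)

Section TestPower.
Variables (R : realType) (T : finType) (P Q : T -> R) (n t : nat) (eps : R).
Hypotheses (P0 : forall x, 0 <= P x) (P1 : \sum_x P x = 1).
Hypotheses (Q0 : forall x, 0 <= Q x) (Q1 : \sum_x Q x = 1).
Hypotheses (Qle : forall x, Q x <= (2 * n%:R)^-1) (Tn : (#|T| <= 5 * n)%N).
Hypotheses (n0 : (0 < n)%N) (t0 : (0 < t)%N) (tn : (t <= n)%N).
Hypotheses (eps0 : 0 < eps) (eps1 : eps <= 1).
Hypothesis far : 2 * eps <= \sum_x `|P x - Q x|.

(** By [hit_gap_ge] the signal is at least a quarter of the sum of [t * a ^+ 2 / (1 + t * a)] with
    [a = |P x - Q x|]. Cauchy-Schwarz bounds that sum below, the denominators adding up to at most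
    [5 * n + 2 * n]. *)
Lemma signal_ge : t%:R / n%:R * eps ^+ 2 / 7 <= signal Q t P.
Proof.
have nr : 0 < n%:R :> R by rewrite ltr0n.
have farS := far; set S := \sum_x `|P x - Q x| in farS.
have S2 : S <= 2 by apply: l1_dist_le2.
(* Cauchy-Schwarz in linear form: [a ^+ 2 / w >= 2 * l * a - l ^+ 2 * w] for every [l]; the choice
   here is [S] over the bound [7 * n] on the sum of the [w]. *)
pose l := S / (7 * n%:R).
suff h : t%:R * (2 * l * S - l ^+ 2 * (#|T|%:R + t%:R * S)) <= 4 * signal Q t P.
  have hN : #|T|%:R + t%:R * S <= 7 * n%:R.
    have : #|T|%:R <= 5 * n%:R :> R by rewrite -natrM ler_nat.
    have : t%:R * S <= n%:R * 2 by rewrite ler_pM ?ler_nat // sumr_ge0.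
    lra.
  have h2 : l ^+ 2 * (#|T|%:R + t%:R * S) <= l * S.
    apply: le_trans (ler_wpM2l (sqr_ge0 _) hN) _.
    rewrite expr2 -mulrA /l [S / _ * (7 * _)]divfK //.
    by rewrite mulf_neq0 ?pnatr_eq0 // -lt0n.
  have h3 : t%:R * (l * S) <= 4 * signal Q t P.
    apply: le_trans h; rewrite ler_wpM2l //; lra.
  have h4 : 4 * eps ^+ 2 <= S ^+ 2.
    have := eps0; nra.
  have h5 : t%:R * (l * S) = t%:R / n%:R / 7 * S ^+ 2.
    by rewrite /l; field; rewrite gt_eqF.
  have : t%:R / n%:R / 7 * (4 * eps ^+ 2) <= t%:R / n%:R / 7 * S ^+ 2.
    by rewrite ler_wpM2l // !divr_ge0.
  lra.
have -> : t%:R * (2 * l * S - l ^+ 2 * (#|T|%:R + t%:R * S)) =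
  \sum_x t%:R * (2 * l * `|P x - Q x| - l ^+ 2 * (1 + t%:R * `|P x - Q x|)).
  rewrite -mulr_sumr sumrB -!mulr_sumr big_split /= sumr_const -!mulr_sumr.
  by rewrite -/S.
rewrite /signal mulr_sumr; apply: ler_sum => x _.
have tQ : t%:R * Q x <= 2^-1.
  apply: (@le_trans _ _ (n%:R * (2 * n%:R)^-1)).
    by rewrite ler_pM ?ler_nat.
  by rewrite invfM mulrCA divff ?mulr1 // gt_eqF.
have Px : 0 <= P x <= 1 by rewrite P0 dist_le1.
have := hit_gap_ge Px (Q0 x) tQ t0.
set a := `|P x - Q x|; set g := `|_ - (1 - Q x) ^+ t| => hg.
have a0 : 0 <= a by apply: normr_ge0.
have w0 : 0 < 1 + t%:R * a by rewrite ltr_pwDl // mulr_ge0.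
rewrite -(ler_pM2r w0).
have h1 := ler_wpM2l a0 hg.
have h2 : 0 <= t%:R * (a - l * (1 + t%:R * a)) ^+ 2 by rewrite mulr_ge0 // sqr_ge0.
lra.
Qed.

(** Here [|X| = b * t] and [|Y| = m]; the last three hypotheses are the lower bounds on [|Y|], [|X|]
    and [|X| |Y|], the second one squared to avoid the root. The constant [50 ^+ 3] is chosen above
    [7 * 8 * 40 ^+ 2], from [signal_ge] and [fires_alternative]. *)
Lemma test_power (b m : nat) : (0 < b)%N -> (0 < m)%N ->
  b = 1%N \/ t = n ->
  50 ^+ 3 <= m%:R * eps ^+ 2 ->
  (50 ^+ 3) ^+ 2 * n%:R <= (b%:R * t%:R * eps ^+ 2) ^+ 2 ->
  (50 ^+ 3) ^+ 2 * n%:R <= b%:R * t%:R * m%:R * (eps ^+ 2) ^+ 2 ->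
  iid (iid (dexp P) t) b (fun Xs =>
    iid (dexp P) m (fun Y => (~~ fires Q n t b m Xs Y)%:R)) <= (10 ^+ 2)^-1.
Proof.
move=> b0 m0 hbt hm hs hsm.
have nr : 0 < n%:R :> R by rewrite ltr0n.
have br : 0 < b%:R :> R by rewrite ltr0n.
have tr : 0 < t%:R :> R by rewrite ltr0n.
have mr : 0 < m%:R :> R by rewrite ltr0n.
have n1 : 1 <= n%:R :> R by rewrite ler1n.
have := signal_ge; set S := signal _ _ _; set u := t%:R / n%:R.
set e := eps ^+ 2 in hm hs hsm *.
have e0 : 0 < e by rewrite exprn_gt0.
have e1 : e <= 1 by rewrite exprn_ile1 // ltW.
have u0 : 0 < u by rewrite divr_gt0.
have tE : t%:R = u * n%:R by rewrite /u divfK // gt_eqF.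
move=> hS; have s0 : 0 < u * e / 7 by rewrite !mulr_gt0 ?invr_gt0.
have S0 : 0 < S := lt_le_trans s0 hS.
set c : R := 50 ^+ 3 in hm hs hsm.
have c0 : 0 < c by rewrite exprn_gt0.
have cE : c = 50 * 50 * 50 by rewrite /c; ring.
have c2 : c <= c ^+ 2 by rewrite expr2 ler_peMl // ?(ltW c0) // cE; lra.
have hsm' : c ^+ 2 <= b%:R * m%:R * u * e ^+ 2.
  rewrite -(ler_pM2r nr); apply: le_trans hsm _.
  by rewrite tE le_eqVlt; apply/orP; left; apply/eqP; ring.
(* Blocks of full length have [u = 1]. With a single block [u] may be small, and the squared
   condition on the reference supplies the missing factor. *)
have K1 : c <= b%:R * t%:R * (u * e).
  case: hbt => [b1|tn1]; last first.
    have -> : u = 1 by rewrite /u tn1 divff // gt_eqF.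
    have w0 : 0 <= b%:R * t%:R * e by rewrite !mulr_ge0 // ltW.
    rewrite mul1r -ler_sqr ?nnegrE ?(ltW c0) //.
    by apply: le_trans hs; apply: ler_peMr; rewrite ?sqr_ge0.
  apply: le_trans c2 _; rewrite b1 mul1r -(ler_pM2r nr).
  move: hs; rewrite b1 mul1r => /le_trans; apply.
  have -> : t%:R * (u * e) * n%:R = t%:R ^+ 2 * e.
    by rewrite /u; field; rewrite gt_eqF.
  by rewrite exprMn ler_wpM2l ?sqr_ge0 // expr2 ler_piMl // ltW.
have K2 : c <= m%:R * (u * e).
  case: hbt => [b1|tn1]; last first.
    have -> : u = 1 by rewrite /u tn1 divff // gt_eqF.
    by rewrite mul1r.
  apply: le_trans c2 _; apply: le_trans hsm' _; rewrite b1 mul1r -mulrA ler_wpM2l //.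
  by rewrite ler_wpM2l ?(ltW u0) // expr2 ler_piMl // ltW.
have lem (x A : R) : 0 <= x -> 7 * A <= x * (u * e) -> A <= x * S.
  move=> x0 hA; have := ler_wpM2l x0 hS; lra.
apply: fires_alternative => //; rewrite -/S.
- by apply: lem; [rewrite mulr_ge0 | lra].
- by apply: lem => //; lra.
- apply: lem => //; rewrite -/u; have := ler_wpM2l (ltW u0) hm; rewrite cE; lra.
have -> : t%:R / (n%:R * b%:R) = u / b%:R by rewrite /u; field; rewrite !gt_eqF.
apply: (@le_trans _ _ (m%:R * (u * e / 7) ^+ 2)); last first.
  by rewrite ler_wpM2l // lerXn2r ?nnegrE ?(ltW s0) ?(ltW S0).
rewrite mulrA ler_pdivrMr //.
have := ler_wpM2l (ltW u0) hsm'; have : u * c <= u * c ^+ 2 by rewrite ler_wpM2l // ltW.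
rewrite cE; lra.
Qed.

End TestPower.

(** * Randomised sampling programs *)

Section Programs.
Variables n k : nat.

(** The trees [alg] with leaves of any type, so that subroutines returning samples, bits or indices
    compose; [to_alg] converts the final program. *)
Inductive prog (A : Type) : Type :=
| Ret of A
| Ask of 'I_k & ('I_n -> prog A)
| Flip of (bool -> prog A).

Fixpoint bind A B (T : prog A) (h : A -> prog B) : prog B :=
  match T with
  | Ret a => h a
  | Ask i f => Ask i (fun x => bind (f x) h)
  | Flip f => Flip (fun c => bind (f c) h)
  end.

Fixpoint cost A (T : prog A) : nat :=
  match T with
  | Ret _ => 0
  | Ask _ f => (\max_(x < n) cost (f x)).+1
  | Flip f => maxn (cost (f false)) (cost (f true))
  end.

Fixpoint rep A (L : nat) (T : prog A) : prog (seq A) :=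
  if L is L'.+1 then bind T (fun a => bind (rep L' T) (fun l => Ret (a :: l)))
  else Ret [::].

Fixpoint to_alg (T : prog {set 'I_k}) : alg n k :=
  match T with
  | Ret out => Leaf n out
  | Ask i f => Query i (fun x => to_alg (f x))
  | Flip f => Coin (fun c => to_alg (f c))
  end.

Lemma num_samples_to_alg T : num_samples (to_alg T) = cost T.
Proof.
elim: T => [S|i f IH|f IH] //=; last by rewrite !IH.
by congr _.+1; apply: eq_bigr => x _.
Qed.

Lemma cost_bind A B (T : prog A) (h : A -> prog B) (c : nat) :
  (forall a, cost (h a) <= c)%N -> (cost (bind T h) <= cost T + c)%N.
Proof.
move=> hc; elim: T => [a|i f IH|f IH] //=.
- rewrite addSn ltnS; apply/bigmax_leqP => x _; apply: leq_trans (IH x) _.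
  by rewrite leq_add2r (leq_bigmax (F := fun x => cost (f x))).

- by rewrite geq_max !(leq_trans (IH _)) // leq_add2r ?leq_maxl ?leq_maxr.
Qed.

Lemma cost_rep A L (T : prog A) : (cost (rep L T) <= L * cost T)%N.
Proof.
elim: L => [|L IH] //=; rewrite mulSn; apply: cost_bind => a.
by apply: leq_trans (@cost_bind _ _ _ _ 0 _) _ => //; rewrite addn0.
Qed.

Section Semantics.
Variables (R : realType) (D : 'I_k -> 'I_n -> R).

Fixpoint ev A (T : prog A) (g : A -> R) : R :=
  match T with
  | Ret a => g a
  | Ask i f => \sum_(x < n) D i x * ev (f x) g
  | Flip f => 2^-1 * (ev (f false) g + ev (f true) g)
  end.

Lemma prob_out_to_alg (good : {set 'I_k} -> bool) T :
  prob_out D good (to_alg T) = ev T (fun S => (good S)%:R).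
Proof.
elim: T => [S|i f IH|f IH] /=; last by rewrite !IH.
  by case: (good S).
by apply: eq_bigr => x _; rewrite IH.
Qed.

Lemma ev_bind A B (T : prog A) (h : A -> prog B) g :
  ev (bind T h) g = ev T (fun a => ev (h a) g).
Proof.
elim: T => [a|i f IH|f IH] //=; last by rewrite !IH.
by apply: eq_bigr => x _; rewrite IH.
Qed.

Hypothesis distD : forall i, is_dist (D i).

Lemma expectation_ev A (T : prog A) : expectation (ev T).
Proof.
elim: T => [a|i f IH|f IH].
- by split => //= f; apply.
- have [p0 p1] := distD i.
  split=> /= [g h|c g|g g0|].
  + rewrite -big_split; apply: eq_bigr => x _ /=.
    by rewrite (expectD (IH x)) mulrDr.
  + by rewrite mulr_sumr; apply: eq_bigr => x _; rewrite (expectZ (IH x)) mulrCA.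
  + by apply: sumr_ge0 => x _; rewrite mulr_ge0 ?(expect_ge0 (IH x)).
  + by rewrite -[RHS]p1; apply: eq_bigr => x _; rewrite (expect1 (IH x)) mulr1.
- split=> /= [g h|c g|g g0|].
  + by rewrite !(expectD (IH _)); ring.
  + by rewrite !(expectZ (IH _)); ring.
  + by rewrite mulr_ge0 ?invr_ge0 // addr_ge0 ?(expect_ge0 (IH _)).
  + by rewrite !(expect1 (IH _)) mulVf // pnatr_eq0.
Qed.

Lemma ev_rep A L (T : prog A) g : ev (rep L T) g = iid (ev T) L g.
Proof.
elim: L g => [|L IH] g //=; rewrite ev_bind.
by apply: (eq_expect (expectation_ev T)) => a; rewrite ev_bind IH.
Qed.

End Semantics.

(** * Fair coins and the flattening of distributions *)

Fixpoint coins (e : nat) : prog nat :=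
  if e is e'.+1 then
    Flip (fun c : bool => bind (coins e') (fun v => Ret (c * 2 ^ e' + v)%N))
  else Ret 0%N.

Lemma cost_coins e : cost (coins e) = 0%N.
Proof.
apply/eqP; rewrite -leqn0; elim: e => [|e IH] //=.
by rewrite geq_max !(leq_trans (@cost_bind _ _ _ _ 0 _)) // addn0.
Qed.

Lemma ev_coins (R : realType) (D : 'I_k -> 'I_n -> R) e g :
  ev D (coins e) g = 2^-1 ^+ e * \sum_(v < 2 ^ e) g v.
Proof.
elim: e g => [|e IH] g /=.
  by rewrite expn0 big_ord1 expr0 mul1r.
rewrite !ev_bind !IH /= expnS mul2n -addnn big_split_ord /= exprS -mulrDr mulrA.
congr (_ * (_ + _)).
by apply: eq_bigr => v _; rewrite mul1n.
Qed.

(** [coins e] returns a natural number; the remainder gives it the dependent type and is the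
    identity on the values that occur. *)
Definition pow2_ord (e v : nat) : 'I_(2 ^ e) :=
  Ordinal (ltn_pmod v (expn_gt0 2 e : 0 < 2 ^ e)%N).

Definition label (e : 'I_n -> nat) : Type := {x : 'I_n & 'I_(2 ^ e x)}.
HB.instance Definition _ e := Finite.on (label e).

(* Splitting each [x] into [2 ^ e x] equally likely copies flattens a distribution. *)
Definition draw (e : 'I_n -> nat) (i : 'I_k) : prog (label e) :=
  Ask i (fun x => bind (coins (e x)) (fun v =>
    Ret (Tagged (fun x => 'I_(2 ^ e x)) (pow2_ord (e x) v)))).

Lemma cost_draw e i : (cost (draw e i) <= 1)%N.
Proof.
rewrite /= ltnS; apply/bigmax_leqP => x _.
by apply: leq_trans (@cost_bind _ _ _ _ 0 _) _ => //; rewrite cost_coins.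
Qed.

Definition flat (R : realType) e (p : 'I_n -> R) (l : label e) : R :=
  p (tag l) * 2^-1 ^+ e (tag l).
Arguments flat {R e} p l.

Lemma sum_label (R : realType) e (F : label e -> R) :
  \sum_l F l = \sum_x \sum_(v < 2 ^ e x) F (Tagged (fun x => 'I_(2 ^ e x)) v).
Proof.
rewrite (@sig_big_dep _ _ _ 'I_n (fun x => 'I_(2 ^ e x) : finType) xpredT
  (fun _ _ => true) (fun x v => F (Tagged (fun x => 'I_(2 ^ e x)) v))) /=.
by apply: eq_bigr => [[x v]].
Qed.

(** Used twice: splitting preserves the total mass and the [L1] distance. *)
Lemma sum_label_tag (R : realType) e (G : 'I_n -> R) :
  \sum_(l : label e) G (tag l) * 2^-1 ^+ e (tag l) = \sum_x G x.
Proof.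
rewrite sum_label; apply: eq_bigr => x _ /=.
rewrite sumr_const card_ord -[X in X = _]mulr_natr natrX -mulrA -exprMn mulVf ?pnatr_eq0 //.
by rewrite expr1n mulr1.
Qed.

Lemma card_label e : #|{: label e}| = (\sum_(x < n) 2 ^ e x)%N.
Proof.
rewrite card_tagged sumnE big_map big_enum.
by apply: eq_bigr => x _; rewrite card_ord.
Qed.

Lemma ev_draw (R : realType) (D : 'I_k -> 'I_n -> R) e i g :
  ev D (draw e i) g = dexp (flat (D i)) g.
Proof.
rewrite /dexp sum_label /=; apply: eq_bigr => x _.
rewrite ev_bind ev_coins /= mulrA mulr_sumr; apply: eq_bigr => v _.
congr (_ * g (Tagged _ _)); apply: val_inj => /=.
by rewrite modn_small.
Qed.

End Programs.

(** * Voting, searching and classifying *)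

Section Algorithm.
Variables (n k : nat).

Definition vote (L : nat) (T : prog n k bool) : prog n k bool :=
  bind (rep L T) (fun l => Ret n k (majority l)).

Fixpoint find_index (N : nat) (pick : prog n k 'I_k) (test : 'I_k -> prog n k bool) :
    prog n k (option 'I_k) :=
  if N is N'.+1 then
    bind pick (fun i => bind (test i) (fun c : bool =>
      if c then Ret n k (Some i) else find_index N' pick test))
  else Ret n k None.

Fixpoint classify (s : seq 'I_k) (test : 'I_k -> prog n k bool) : prog n k {set 'I_k} :=
  if s is j :: s' then
    bind (test j) (fun c : bool => bind (classify s' test) (fun S =>
      Ret n k (if c then j |: S else S)))
  else Ret n k set0.

(** Finitely many fair coins give a uniform index only when [k] is a power of two; the remainder
    modulo [k] is uneven, but a lower bound on the chance of each index suffices. *)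
Definition pick_index (k0 : (0 < k)%N) (J : nat) : prog n k 'I_k :=
  bind (coins n k J) (fun v => Ret n k (Ordinal (ltn_pmod v k0))).

Lemma cost_vote L T : (cost (vote L T) <= L * cost T)%N.
Proof.
by rewrite -[(L * _)%N]addn0; apply: leq_trans (cost_bind (c := 0) _ _) _ => //;
  rewrite leq_add2r cost_rep.
Qed.

Lemma cost_find_index N pick test c : cost pick = 0%N ->
  (forall i, cost (test i) <= c)%N -> (cost (find_index N pick test) <= N * c)%N.
Proof.
move=> hp hc; elim: N => [|N IH] //=.
apply: leq_trans (cost_bind (c := N.+1 * c) _ _) _; last by rewrite hp.
move=> i; rewrite mulSn; apply: leq_trans (cost_bind (c := N * c) _ _) _.
  by case.
by rewrite leq_add2r.
Qed.

Lemma cost_classify s test c :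
  (forall i, cost (test i) <= c)%N -> (cost (classify s test) <= size s * c)%N.
Proof.
move=> hc; elim: s => [|j s IH] //=; rewrite mulSn.
apply: leq_trans (cost_bind (c := size s * c) _ _) _; last by rewrite leq_add2r.
by move=> b; rewrite -[(size s * c)%N]addn0; apply: leq_trans (cost_bind (c := 0) _ _) _;
  rewrite ?leq_add2r.
Qed.

Lemma cost_pick_index k0 J : cost (pick_index k0 J) = 0%N.
Proof.
apply/eqP; rewrite -leqn0.
by apply: leq_trans (cost_bind (c := 0) _ _) _ => //; rewrite cost_coins.
Qed.

Variables (R : realType) (D : 'I_k -> 'I_n -> R).
Hypothesis distD : forall i, is_dist (D i).
Variable I : {set 'I_k}.

Lemma vote_error L T v : ev D T (fun c => (c != v)%:R) <= 10^-1 ->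
  ev D (vote L T) (fun c => (c != v)%:R) <= (3 / 5) ^+ L.
Proof.
move=> h; rewrite ev_bind ev_rep //=; apply: majority_error => //.
exact: expectation_ev.
Qed.

(** The first [k] outcomes hit each index once, each with chance at least [1 / (2 * k)]; the others
    can only help. *)
Lemma pick_index_hit k0 J : (k <= 2 ^ J)%N -> (2 ^ J <= 2 * k)%N ->
  #|I|%:R / (2 * k%:R) <= ev D (pick_index k0 J) (fun i => (i \in I)%:R).
Proof.
move=> kJ Jk; rewrite ev_bind ev_coins /=.
pose f (v : nat) : R := (Ordinal (ltn_pmod v k0) \in I)%:R.
rewrite (_ : \sum_(v < 2 ^ J) _ = \sum_(0 <= v < 2 ^ J) f v); last by rewrite big_mkord.
rewrite (big_cat_nat (leq0n k) kJ) /=.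
have -> : \sum_(0 <= v < k) f v = #|I|%:R.
  rewrite big_mkord -sum1_card natr_sum [RHS]big_mkcond /=; apply: eq_bigr => v _.
  rewrite /f (_ : Ordinal _ = v); first by case: (v \in I).
  by apply: val_inj; rewrite /= modn_small.
apply: (@le_trans _ _ (2^-1 ^+ J * #|I|%:R)); last first.
  by rewrite ler_wpM2l ?exprn_ge0 ?invr_ge0 // lerDl sumr_ge0.
rewrite mulrC ler_wpM2r // exprVn lef_pV2 ?posrE ?exprn_gt0 ?mulr_gt0 ?ltr0n //.
by rewrite -natrX -natrM ler_nat.
Qed.

Definition in_cluster (o : option 'I_k) : bool := if o is Some i then i \in I else false.

(** One round turns the failure bound [F] into at most [a + (1 - 9 / 10 * p) * F]: a wrong index is
    accepted with chance at most [a], and a good one is drawn and accepted with chance at least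
    [9 / 10 * p]. *)
Lemma find_index_error N pick test (a p : R) :
  0 <= a -> a <= 10^-1 -> 0 <= p ->
  p <= ev D pick (fun i => (i \in I)%:R) ->
  (forall i, ev D (test i) (fun c => (c != (i \in I))%:R) <= a) ->
  ev D (find_index N pick test) (fun o => (~~ in_cluster o)%:R) <=
  N%:R * a + (1 - 9 / 10 * p) ^+ N.
Proof.
move=> a0 a1 p0 hp ht.
have hE A (T : prog n k A) : expectation (ev D T) by apply: expectation_ev.
have p1 : p <= 1.
  apply: le_trans hp _; rewrite -[leRHS](expect_cst (hE _ pick)).
  by apply: (expect_le (hE _ pick)) => i; rewrite lern1 leq_b1.
elim: N => [|N IH] /=; first by rewrite mul0r add0r expr0.
set F := ev D (find_index N pick test) _ in IH.
have F0 : 0 <= F by apply: (expect_ge0 (hE _ _)).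
rewrite ev_bind.
apply: (@le_trans _ _ (ev D pick (fun i => a + (F + (- (9 / 10) * F) * (i \in I)%:R)))).
  apply: (expect_le (hE _ pick)) => i; rewrite ev_bind.
  have [iI|iI] := boolP (i \in I); last first.
    apply: (@le_trans _ _ (ev D (test i) (fun c => (c != (i \in I))%:R + F))).
      apply: (expect_le (hE _ _)) => -[] /=; rewrite (negbTE iI) /= ?addr0 ?lerDl //.
      by rewrite add0r.
    by rewrite (expectD (hE _ _)) (expect_cst (hE _ _)) mulr0 addr0 lerD2r.
  apply: (@le_trans _ _ (ev D (test i) (fun c => F * (c != (i \in I))%:R))).
    apply: (expect_le (hE _ _)) => -[] /=; rewrite iI /= ?mulr0 ?mulr1 //.
  rewrite (expectZ (hE _ _)).
  have := ler_wpM2l F0 (ht i); have : F * a <= F * 10^-1 by rewrite ler_wpM2l.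
  rewrite mulr1; move: a0; lra.
rewrite !(expectD (hE _ _)) !(expect_cst (hE _ _)) (expectZ (hE _ _)).
set q := ev D pick _ in hp *.
have h1 : F * p <= F * q by rewrite ler_wpM2l.
have h2 : (1 - 9 / 10 * p) * F <= (1 - 9 / 10 * p) * (N%:R * a + (1 - 9 / 10 * p) ^+ N).
  by rewrite ler_wpM2l //; lra.
have h3 : 0 <= p * (N%:R * a) by rewrite !mulr_ge0.
rewrite exprS -[N.+1%:R]natr1; lra.
Qed.

Lemma classify_error s test (a : R) : uniq s ->
  (forall i, ev D (test i) (fun c => (c != (i \in I))%:R) <= a) ->
  ev D (classify s test) (fun S => (S != [set j in s | j \in I])%:R) <= (size s)%:R * a.
Proof.
have hE A (T : prog n k A) : expectation (ev D T) by apply: expectation_ev.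
move=> + ht; elim: s => [|j s IH] /=.
  have -> : [set j in [::] | j \in I] = set0 by apply/setP => x; rewrite !inE.
  by rewrite eqxx mul0r.
move=> /andP[js us]; rewrite ev_bind.
apply: (@le_trans _ _ (ev D (test j) (fun c => (c != (j \in I))%:R +
   ev D (classify s test) (fun S => (S != [set j in s | j \in I])%:R)))); last first.
  rewrite (expectD (hE _ _)) (expect_cst (hE _ _)) -[(size s).+1%:R]natr1 mulrDl mul1r addrC.
  by rewrite lerD // IH.
apply: (expect_le (hE _ _)) => c; rewrite ev_bind /=.
rewrite -{1}[(c != _)%:R](expect_cst (hE _ (classify s test))) -(expectD (hE _ _)).
apply: (expect_le (hE _ _)) => S.
have [->|_] := eqVneq c (j \in I); last first.
  by apply: (@le_trans _ _ 1); [rewrite lern1 leq_b1 | rewrite lerDl].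
have [->|_] := eqVneq S [set j in s | j \in I]; last first.
  by rewrite add0r lern1 leq_b1.
have -> : (if j \in I then j |: [set j in s | j \in I] else [set j in s | j \in I]) =
    [set i in j :: s | i \in I].
  apply/setP => x; rewrite [RHS]inE in_cons.
  by case: ifP => jI; rewrite !inE; case: eqVneq => [->|_] //=; rewrite ?jI ?andbF.
by rewrite eqxx addr0.
Qed.

End Algorithm.

(** * The clustering program *)

Record adequate_sizes (R : realType) (n : nat) (eps : R) (t b m : nat) : Prop := {
  adequate_t : (0 < t <= n)%N;
  adequate_b : (0 < b)%N;
  adequate_m : (0 < m)%N;
  adequate_bt : b = 1%N \/ t = n;
  adequate_m_ge : 50 ^+ 3 <= m%:R * eps ^+ 2;
  adequate_bt_ge : (50 ^+ 3) ^+ 2 * n%:R <= (b%:R * t%:R * eps ^+ 2) ^+ 2;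
  adequate_btm_ge : (50 ^+ 3) ^+ 2 * n%:R <= b%:R * t%:R * m%:R * (eps ^+ 2) ^+ 2 }.

Section Clustering.
Variables (R : realType) (n k : nat) (Q : 'I_n -> R) (e : 'I_n -> nat).
Hypothesis k0 : (0 < k)%N.

Definition reference (t b : nat) (i : 'I_k) : prog n k (seq (seq (label e))) :=
  rep b (rep t (draw e i)).

Definition probe (t b m : nat) (Xs : seq (seq (label e))) (j : 'I_k) : prog n k bool :=
  bind (rep m (draw e j)) (fun Y => Ret n k (fires (flat Q) n t b m Xs Y)).

Definition trial (t b m : nat) (i : 'I_k) : prog n k bool :=
  bind (reference t b i) (fun Xs => probe t b m Xs i).

(** In the search every vote redraws its reference; in the classification one reference is shared by
    all votes on all indices, so its cost is paid once. [set0] is an arbitrary answer after a failed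
    search. *)
Definition cluster (L N J t1 b1 m1 t2 b2 m2 : nat) : prog n k {set 'I_k} :=
  bind (find_index N (pick_index n k0 J) (fun i => vote L (trial t1 b1 m1 i))) (fun o =>
    if o is Some i then
      bind (reference t2 b2 i) (fun Xs =>
        classify (enum 'I_k) (fun j => vote L (probe t2 b2 m2 Xs j)))
    else Ret n k set0).

Lemma cost_reference t b i : (cost (reference t b i) <= b * t)%N.
Proof.
apply: leq_trans (cost_rep _ _) _; rewrite leq_mul2l; apply/orP; right.
by apply: leq_trans (cost_rep _ _) _; rewrite -{2}[t]muln1 leq_mul2l cost_draw orbT.
Qed.

Lemma cost_probe t b m Xs j : (cost (probe t b m Xs j) <= m)%N.
Proof.
rewrite -{2}[m]addn0; apply: leq_trans (cost_bind (c := 0) _ _) _ => //.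
rewrite leq_add2r; apply: leq_trans (cost_rep _ _) _.
by rewrite -{2}[m]muln1 leq_mul2l cost_draw orbT.
Qed.

Lemma cost_trial t b m i : (cost (trial t b m i) <= b * t + m)%N.
Proof.
apply: leq_trans (cost_bind (c := m) _ _) _; first by move=> Xs; exact: cost_probe.
by rewrite leq_add2r cost_reference.
Qed.

Lemma cost_cluster L N J t1 b1 m1 t2 b2 m2 :
  (cost (cluster L N J t1 b1 m1 t2 b2 m2) <=
   N * (L * (b1 * t1 + m1)) + (b2 * t2 + k * (L * m2)))%N.
Proof.
apply: leq_trans (cost_bind (c := b2 * t2 + k * (L * m2)) _ _) _.
  case=> [i|] //; apply: leq_trans (cost_bind (c := k * (L * m2)) _ _) _.
    move=> Xs; rewrite -[X in (_ <= X * _)%N](size_enum_ord k).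
    apply: cost_classify => j.
    by apply: leq_trans (cost_vote _ _) _; rewrite leq_mul2l cost_probe orbT.
  by rewrite leq_add2r cost_reference.
rewrite leq_add2r; apply: cost_find_index => [|i]; first exact: cost_pick_index.
by apply: leq_trans (cost_vote _ _) _; rewrite leq_mul2l cost_trial orbT.
Qed.

Variables (eps : R) (P : 'I_n -> R) (I : {set 'I_k}).
Hypotheses (distP : is_dist P) (distQ : is_dist Q).
Hypotheses (n0 : (0 < n)%N) (eps0 : 0 < eps) (eps1 : eps <= 1).
Hypothesis far : eps <= dTV P Q.
Hypothesis flatQ : forall x, Q x * 2^-1 ^+ e x <= (2 * n%:R)^-1.
Hypothesis card_e : (#|{: label e}| <= 5 * n)%N.

Let D (i : 'I_k) : 'I_n -> R := if i \in I then P else Q.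

Let distD i : is_dist (D i).
Proof. by rewrite /D; case: ifP. Qed.

Lemma flat_ge0 (p : 'I_n -> R) (l : label e) : is_dist p -> 0 <= flat p l.
Proof. by move=> [p0 _]; rewrite mulr_ge0 // exprn_ge0 ?invr_ge0. Qed.

Lemma flat_sum1 (p : 'I_n -> R) : is_dist p -> \sum_(l : label e) flat p l = 1.
Proof. by move=> [_ p1]; rewrite -p1 -(sum_label_tag e). Qed.

Let hE A (T : prog n k A) : expectation (ev D T) := expectation_ev distD T.

Lemma ev_reference t b i g :
  ev D (reference t b i) g = iid (iid (dexp (flat (D i))) t) b g.
Proof.
rewrite ev_rep //; apply: eq_iid => // h; rewrite ev_rep //.
by apply: eq_iid => // ?; rewrite ev_draw.
Qed.

Lemma ev_probe t b m Xs j g :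
  ev D (probe t b m Xs j) g =
  iid (dexp (flat (D j))) m (fun Y => g (fires (flat Q) n t b m Xs Y)).
Proof.
by rewrite ev_bind ev_rep //; apply: eq_iid => // ?; rewrite ev_draw.
Qed.

Section Probe.
Variables (t b m : nat) (ok : adequate_sizes n eps t b m).

Lemma probe_null Xs j : j \notin I ->
  ev D (probe t b m Xs j) (fun c => (c != (j \in I))%:R) <= 10^-1.
Proof.
move=> jI; rewrite ev_probe (negbTE jI) /D (negbTE jI).
have [/andP[t0 _] b0 m0 _ _ _ _] := ok.
have := @fires_null _ _ (flat (e := e) Q) n t b m n0 t0 b0 m0 Xs
  (fun l => flat_ge0 l distQ) (flat_sum1 distQ).
apply: le_trans; rewrite le_eqVlt; apply/orP; left; apply/eqP.
apply: (eq_expect (expectation_iid _ (expectation_dexp _ _))).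
- by move=> x; exact: flat_ge0.
- exact: flat_sum1.
- by move=> Y; case: fires.
Qed.

(** The bound [1 / 100], stronger than the [1 / 10] needed by a vote, leaves room for Markov's
    inequality over references in [classify_stage_error]. *)
Lemma reference_power i : i \in I ->
  ev D (reference t b i) (fun Xs =>
    iid (dexp (flat P)) m (fun Y => (~~ fires (flat Q) n t b m Xs Y)%:R))
  <= (10 ^+ 2)^-1.
Proof.
move=> iI; rewrite ev_reference /D iI.
have [/andP[t0 tn] b0 m0 bt h1 h2 h3] := ok.
apply: test_power h1 h2 h3 => //.
- by move=> x; exact: flat_ge0.
- exact: flat_sum1.
- by move=> x; exact: flat_ge0.
- exact: flat_sum1.
- by move=> x; exact: flatQ.
have -> : \sum_(l : label e) `|flat P l - flat Q l| = \sum_x `|P x - Q x|.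
  rewrite -(sum_label_tag e); apply: eq_bigr => l _.
  by rewrite /flat -mulrBl normrM [`|_ ^+ _|]ger0_norm // exprn_ge0 ?invr_ge0.
have := far; rewrite /dTV; lra.
Qed.

Lemma probe_alternative Xs j : j \in I ->
  ev D (probe t b m Xs j) (fun c => (c != (j \in I))%:R) =
  iid (dexp (flat P)) m (fun Y => (~~ fires (flat Q) n t b m Xs Y)%:R).
Proof.
move=> jI; rewrite ev_probe jI /D jI.
apply: (eq_expect (expectation_iid _ (expectation_dexp _ _))).
- by move=> x; exact: flat_ge0.
- exact: flat_sum1.
- by move=> Y; case: fires.
Qed.

Lemma trial_error i : ev D (trial t b m i) (fun c => (c != (i \in I))%:R) <= 10^-1.
Proof.
rewrite ev_bind; have [iI|iI] := boolP (i \in I); last first.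
  rewrite -[leRHS](expect_cst (hE (reference t b i))).
  apply: (expect_le (hE _)) => Xs; have := probe_null Xs iI.
  by rewrite (negbTE iI).
apply: (@le_trans _ _ (10 ^+ 2)^-1); last by rewrite expr2; lra.
apply: le_trans (reference_power iI).
apply: (expect_le (hE _)) => Xs; have := probe_alternative Xs iI.
by rewrite iI => ->.
Qed.

(** Votes sharing a reference are independent only once it is fixed. For a good reference, one for
    which a probe errs with chance at most [1 / 10], a union bound over the [k] majorities
    applies. *)
Lemma classify_stage_error L i : i \in I ->
  ev D (bind (reference t b i) (fun Xs =>
      classify (enum 'I_k) (fun j => vote L (probe t b m Xs j))))
    (fun S => (S != I)%:R) <= k%:R * (3 / 5) ^+ L + 10^-1.
Proof.
move=> iI; rewrite ev_bind; set a : R := (3 / 5) ^+ L.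
have a0 : 0 <= a by rewrite exprn_ge0 // divr_ge0.
pose pX (Xs : seq (seq (label e))) : R :=
  iid (dexp (flat P)) m (fun Y => (~~ fires (flat Q) n t b m Xs Y)%:R).
have pX0 Xs : 0 <= pX Xs.
  apply: (expect_ge0 (expectation_iid _ (expectation_dexp _ _))) => // [x|].
    exact: flat_ge0.
  exact: flat_sum1.
(* Markov's inequality in pointwise form: [10 * pX Xs] is at least 1 on bad references and has mean
   at most [10 / 100]. *)
apply: (@le_trans _ _ (ev D (reference t b i) (fun Xs => k%:R * a + 10 * pX Xs))); last first.
  rewrite (expectD (hE _)) (expect_cst (hE _)) (expectZ (hE _)) lerD2l.
  have := reference_power iI; rewrite -/(pX _) expr2; lra.
apply: (expect_le (hE _)) => Xs.
have [hX|hX] := leP (pX Xs) 10^-1; last first.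
  apply: (@le_trans _ _ 1); last by have : 0 <= k%:R * a; [rewrite mulr_ge0 | lra].
  rewrite -[leRHS](expect_cst (hE (classify (enum 'I_k) (fun j => vote L (probe t b m Xs j))))).
  by apply: (expect_le (hE _)) => S; rewrite lern1 leq_b1.
apply: (@le_trans _ _ (k%:R * a)); last by rewrite lerDl mulr_ge0.
have := @classify_error n k R D distD I (enum 'I_k)
  (fun j => vote L (probe t b m Xs j)) a (enum_uniq _).
have -> : [set j in enum 'I_k | j \in I] = I.
  by apply/setP => x; rewrite inE mem_enum.
rewrite -cardE card_ord; apply => j; apply: vote_error => //.
have [jI|jI] := boolP (j \in I); last by have := probe_null Xs jI; rewrite (negbTE jI).
by have := probe_alternative Xs jI; rewrite jI => ->.
Qed.

End Probe.

Lemma cluster_success L N J t1 b1 m1 t2 b2 m2 :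
  adequate_sizes n eps t1 b1 m1 -> adequate_sizes n eps t2 b2 m2 ->
  (k <= 2 ^ J)%N -> (2 ^ J <= 2 * k)%N -> (3 / 5) ^+ L <= 10^-1 :> R ->
  1 - (N%:R * (3 / 5) ^+ L + (1 - 9 / 10 * (#|I|%:R / (2 * k%:R))) ^+ N
       + (k%:R * (3 / 5) ^+ L + 10^-1)) <=
  prob_out D (correct_partition I) (to_alg (cluster L N J t1 b1 m1 t2 b2 m2)).
Proof.
move=> ok1 ok2 kJ Jk hL; rewrite prob_out_to_alg; set T := cluster _ _ _ _ _ _ _ _ _.
set a : R := (3 / 5) ^+ L in hL *.
have a0 : 0 <= a by rewrite exprn_ge0 // divr_ge0.
have -> : ev D T (fun S => (correct_partition I S)%:R) =
    1 - ev D T (fun S => (~~ correct_partition I S)%:R).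
  rewrite -[X in X - _](expect_cst (hE T)) -(expectB (hE T)).
  by apply: (eq_expect (hE T)) => S; case: correct_partition; rewrite /= ?subr0 ?subrr.
rewrite lerD2l lerN2 /T /cluster ev_bind.
set F := find_index _ _ _.
apply: (@le_trans _ _ (ev D F (fun o => (~~ in_cluster I o)%:R + (k%:R * a + 10^-1)))).
  have c0 : 0 <= k%:R * a + 10^-1 by rewrite addr_ge0 ?mulr_ge0 ?invr_ge0.
  apply: (expect_le (hE F)) => -[i|] /=; last first.
    by apply: (@le_trans _ _ 1); rewrite ?lern1 ?leq_b1 ?lerDl.
  have [iI|iI] := boolP (i \in I) => /=.
    rewrite add0r; apply: le_trans (classify_stage_error ok2 L iI).
    apply: (expect_le (hE _)) => S; rewrite ler_nat /correct_partition.
    by case: (S == I) => //=; rewrite leq_b1.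
  apply: (@le_trans _ _ 1); last by rewrite lerDl.
  set T' := bind _ _; rewrite -[leRHS](expect_cst (hE T')).
  by apply: (expect_le (hE _)) => S; rewrite lern1 leq_b1.
rewrite (expectD (hE F)) (expect_cst (hE F)) lerD2r.
apply: find_index_error => //.
- by rewrite divr_ge0 ?mulr_ge0.
- exact: pick_index_hit.
- by move=> i; apply: vote_error => //; exact: trial_error.
Qed.

End Clustering.

(** * Choice of the parameters *)

Section SampleSizes.
Variable R : realType.

Lemma exists_pow2_near (y : R) : 0 <= y ->
  exists j : nat, y <= 2 ^+ j /\ 2 ^+ j <= 1 + 2 * y.
Proof.
move=> y0; have ex : exists j, y <= 2 ^+ j.
  exists (Num.bound y); apply: le_trans (ltW (archi_boundP y0)) _.
  by rewrite -natrX ler_nat ltnW // ltn_expl.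
case: (ex_minnP ex) => -[|j] hj hmin.
  by exists 0%N; split => //; rewrite expr0; lra.
exists j.+1; split => //.
have : 2 ^+ j < y by rewrite ltNge; apply/negP => /hmin; rewrite ltnn.
rewrite exprS; lra.
Qed.

(** The minimality clause later turns [s <= n] into [t <= n]. *)
Lemma exists_nat_near (x : R) : 1 <= x ->
  exists N : nat, [/\ (0 < N)%N, x <= N%:R, N%:R <= 2 * x &
    forall M : nat, x <= M%:R -> (N <= M)%N].
Proof.
move=> x1; have x0 : 0 <= x by lra.
have ex : exists N : nat, x <= N%:R by exists (Num.bound x); exact/ltW/archi_boundP.
case: (ex_minnP ex) => -[|N] hN hmin; first by move: hN; lra.
exists N.+1; split => //; have : N%:R < x.
  by rewrite ltNge; apply/negP => /hmin; rewrite ltnn.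
rewrite -natr1; lra.
Qed.

(** A reference of size at most [n] is a single block; a longer one is cut into blocks of full
    length [n]. *)
Lemma exists_block_sizes (n : nat) (s : R) : (0 < n)%N -> 1 <= s ->
  exists t b : nat, [/\ (0 < t <= n)%N, (0 < b)%N, b = 1%N \/ t = n,
    s <= b%:R * t%:R & b%:R * t%:R <= 2 * s].
Proof.
move=> n0 s1; have nr : 0 < n%:R :> R by rewrite ltr0n.
have [sn|ns] := leP s n%:R.
  have [t [t0 h1 h2 h3]] := exists_nat_near s1.
  by exists t, 1%N; rewrite t0 h3 // mul1r; split => //; left.
have s2 : 1 <= s / n%:R by rewrite ler_pdivlMr // mul1r ltW.
have [b [b0 h1 h2 _]] := exists_nat_near s2.
exists n, b; split => //; first by rewrite n0 leqnn.
- by right.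
- by rewrite -ler_pdivrMr.
- by rewrite -ler_pdivlMr // -mulrA.
Qed.

(** The hypotheses force [s] and [m] to be at least 1, so rounding to integers at most doubles
    them. *)
Lemma exists_adequate_sizes (n : nat) (eps s m : R) :
  (0 < n)%N -> 0 < eps -> eps <= 1 -> 0 <= s ->
  50 ^+ 3 <= m * eps ^+ 2 ->
  (50 ^+ 3) ^+ 2 * n%:R <= (s * eps ^+ 2) ^+ 2 ->
  (50 ^+ 3) ^+ 2 * n%:R <= s * m * (eps ^+ 2) ^+ 2 ->
  exists t b M : nat,
    [/\ adequate_sizes n eps t b M, (b * t)%:R <= 2 * s & M%:R <= 2 * m].
Proof.
move=> n0 e0 e1 s0 h1 h2 h3.
have E0 : 0 < eps ^+ 2 by rewrite exprn_gt0.
have E1 : eps ^+ 2 <= 1 by rewrite exprn_ile1 // ltW.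
have n1 : 1 <= n%:R :> R by rewrite ler1n.
have c1 : 1 <= 50 ^+ 3 :> R by rewrite exprn_ege1 // ler1n.
have m1 : 1 <= m.
  have m0 : 0 <= m by rewrite -(pmulr_lge0 _ E0); lra.
  have : m * eps ^+ 2 <= m by rewrite ler_piMr.
  lra.
have s1 : 1 <= s.
  have : 1 <= s * eps ^+ 2.
    have w0 : 0 <= s * eps ^+ 2 by rewrite mulr_ge0 // ltW.
    rewrite -(@ler_sqr R) ?nnegrE ?w0 //; apply: le_trans h2.
    by rewrite expr1n mulr_ege1 // exprn_ege1.
  have : s * eps ^+ 2 <= s by rewrite ler_piMr.
  lra.
have [t [b [ht hb hbt g1 g2]]] := exists_block_sizes n0 s1.
have [M [M0 k1 k2 _]] := exists_nat_near m1.
exists t, b, M; split => //; last by rewrite natrM.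
split => //.
- by apply: le_trans h1 _; rewrite ler_wpM2r // ltW.
- apply: le_trans h2 _; apply: lerXn2r; rewrite ?nnegrE.
  + by rewrite mulr_ge0 // ltW.
  + by rewrite !mulr_ge0 // ltW.
  + by rewrite ler_wpM2r // ltW.
- apply: le_trans h3 _; rewrite ler_wpM2r ?sqr_ge0 // ler_pM //; lra.
Qed.

(** Equivalent to [exp (1 / 2) <= 2], which follows from [exp (- 1 / 2) >= 1 - 1 / 2]. *)
Lemma ln2_ge : 2^-1 <= ln (2 : R).
Proof.
rewrite -(ler_expR) lnK ?posrE //.
have := expR_ge1Dx (- 2^-1 : R); rewrite expRN.
have := expR_gt0 (2^-1 : R); set x := sequences.expR _ => x0.
have -> : 1 + - 2^-1 = 2^-1 :> R by lra.
by rewrite lef_pV2 ?posrE.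
Qed.

Lemma trunc_logS_le (k : nat) : (2 <= k)%N ->
  (trunc_log 2 k).+1%:R <= 4 * ln (k%:R : R).
Proof.
move=> k2; have k0 : (0 < k)%N by apply: leq_trans k2.
set l := trunc_log 2 k.
have l1 : (1 <= l)%N by rewrite /l -(trunc_expnK 1 (isT : 1 < 2)%N) leq_trunc_log.
have h : l%:R * ln (2 : R) <= ln (k%:R : R).
  rewrite mulr_natl -lnXn // ler_ln ?posrE ?exprn_gt0 ?ltr0n // -natrX ler_nat.
  by have /andP[] := trunc_log_bounds (isT : 1 < 2)%N k0.
have h2 : l%:R * 2^-1 <= l%:R * ln (2 : R) by rewrite ler_wpM2l // ln2_ge.
have : 1 <= l%:R :> R by rewrite ler1n.
rewrite -natr1; lra.
Qed.

Lemma vote_count_suffices (l k : nat) : (0 < k)%N -> (k < 2 ^ l)%N ->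
  (3 / 5) ^+ (16 * l) <= (400 * k%:R)^-1 :> R.
Proof.
move=> k0 kl; rewrite exprM.
have l0 : (0 < l)%N by case: l kl => //; rewrite expn0 ltnS leqNgt k0.
(* Sixteen votes give [(3 / 5) ^+ 16 <= 1 / 800]; the factor [2 ^+ l] of [800 ^+ l] then exceeds
   [k]. *)
apply: (@le_trans _ _ ((400 * 2)^-1 ^+ l)).
  rewrite lerXn2r ?nnegrE ?exprn_ge0 ?invr_ge0 ?divr_ge0 ?mulr_ge0 //; lra.
rewrite exprVn lef_pV2 ?posrE ?exprn_gt0 ?mulr_gt0 ?ltr0n //.
rewrite exprMn ler_pM //; last by rewrite -natrX ler_nat ltnW.
by rewrite -{1}[400]expr1 ler_weXn2l // ler1n.
Qed.

End SampleSizes.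

Section ExponentChoice.
Variables (R : realType) (n : nat) (Q : 'I_n -> R).

(** [2 ^ e x] is [2 * n * Q x] rounded up to a power of two, at most [1 + 4 * n * Q x]; summing over
    [x] gives [n + 4 * n] copies. *)
Lemma exists_flattening : (0 < n)%N -> is_dist Q ->
  exists e : 'I_n -> nat,
    (forall x, Q x * 2^-1 ^+ e x <= (2 * n%:R)^-1) /\ (#|{: label e}| <= 5 * n)%N.
Proof.
move=> n0 [Q0 Q1]; have nr : 0 < n%:R :> R by rewrite ltr0n.
have [e he] := fin_all_exists (fun x =>
  exists_pow2_near (mulr_ge0 (mulr_ge0 (ler0n R 2) (ler0n R n)) (Q0 x))).
exists e; split => [x|].
  have [h _] := he x.
  rewrite exprVn ler_pdivrMr ?exprn_gt0 // mulrC ler_pdivlMr ?mulr_gt0 //.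
  by rewrite mulrC.
rewrite card_label -(ler_nat R) natr_sum.
apply: (@le_trans _ _ (\sum_x (1 + 2 * (2 * n%:R * Q x)))).
  by apply: ler_sum => x _; rewrite natrX; case: (he x).
rewrite big_split /= sumr_const card_ord -!mulr_sumr Q1 natrM mulr1; lra.
Qed.

End ExponentChoice.

Section Bound.
Variables (R : realType) (n k : nat) (eps : R).
Hypotheses (n0 : (0 < n)%N) (k2 : (2 <= k)%N).
Hypotheses (eps0 : 0 < eps) (eps1 : eps <= 1).

Let K : R := k%:R * ln k%:R.
Let s2 : R := if K <= n%:R then Num.sqrt (n%:R * K) / eps ^+ 2 else K / eps ^+ 2.

Lemma klnk_ge1 : 1 <= K.
Proof.
have h : ln (2 : R) <= ln k%:R by rewrite ler_ln ?posrE ?ltr0n ?ler_nat // (leq_trans _ k2).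
have : 2 * 2^-1 <= K.
  by rewrite ler_pM ?ler_nat ?invr_ge0 // (le_trans (@ln2_ge R)).
lra.
Qed.

(** The search pays for both samples at each attempt, so they get equal size, and the product
    condition makes it of order [sqrt n / eps ^+ 2]. *)
Lemma search_sizes : exists t b m : nat, adequate_sizes n eps t b m /\
  (b * t + m)%:R <= 4 * (50 ^+ 3 * (Num.sqrt n%:R / eps ^+ 2)).
Proof.
have E0 : 0 < eps ^+ 2 by rewrite exprn_gt0.
have c0 : 0 <= 50 ^+ 3 :> R by rewrite exprn_ge0.
pose s : R := 50 ^+ 3 * (Num.sqrt n%:R / eps ^+ 2).
have q0 : 0 <= Num.sqrt n%:R :> R by exact: sqrtr_ge0.
have q1 : 1 <= Num.sqrt n%:R :> R by rewrite -[leLHS]sqrtr1 ler_sqrt ?ler1n ?ler0n ?ltr0n.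
have q2 : Num.sqrt n%:R ^+ 2 = n%:R :> R by rewrite sqr_sqrtr.
have s0 : 0 <= s by rewrite mulr_ge0 // divr_ge0 // ltW.
have sE : s * eps ^+ 2 = 50 ^+ 3 * Num.sqrt n%:R by rewrite /s -mulrA divfK ?gt_eqF.
have [|||t [b [m [ok h1 h2]]]] := @exists_adequate_sizes R n eps s s n0 eps0 eps1 s0.
- by rewrite sE ler_peMr.
- by rewrite sE [(50 ^+ 3 * _) ^+ 2]exprMn q2.
- have -> : s * s * (eps ^+ 2) ^+ 2 = (s * eps ^+ 2) ^+ 2 by ring.
  by rewrite sE [(50 ^+ 3 * _) ^+ 2]exprMn q2.
exists t, b, m; split => //; rewrite natrD -/s; lra.
Qed.

(** The reference is paid for once and a probe about [K] times, so [m = s / K] balances the two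
    costs. *)
Lemma classification_sizes : exists t b m : nat, [/\ adequate_sizes n eps t b m,
  (b * t)%:R <= 2 * (50 ^+ 3 * s2) & K * m%:R <= 2 * (50 ^+ 3 * s2)].
Proof.
have E0 : 0 < eps ^+ 2 by rewrite exprn_gt0.
have c0 : 0 <= 50 ^+ 3 :> R by rewrite exprn_ge0.
have c20 : 0 <= (50 ^+ 3) ^+ 2 :> R by rewrite sqr_ge0.
have K1 := klnk_ge1; have K0 : 0 < K by lra.
have n1 : 1 <= n%:R :> R by rewrite ler1n.
(* In both cases [q] is the larger of [sqrt (n * K)] and [K]: [K <= q] gives enough test samples,
   and [n * K <= q ^+ 2] the product condition. *)
suff [q [qK q1 q2]] : exists q : R, [/\ s2 = q / eps ^+ 2, K <= q & n%:R * K <= q ^+ 2].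
  pose s : R := 50 ^+ 3 * s2; pose m : R := s / K.
  have q0 : 0 <= q by lra.
  have s0 : 0 <= s by rewrite mulr_ge0 // qK divr_ge0 // ltW.
  have sE : s * eps ^+ 2 = 50 ^+ 3 * q by rewrite /s qK -mulrA divfK ?gt_eqF.
  have mE : m * eps ^+ 2 = 50 ^+ 3 * (q / K) by rewrite /m mulrAC sE mulrA.
  have [|||t [b [M [ok h1 h2]]]] := @exists_adequate_sizes R n eps s m n0 eps0 eps1 s0.
  - by rewrite mE ler_peMr // ler_pdivlMr // mul1r.
  - rewrite sE [(50 ^+ 3 * _) ^+ 2]exprMn ler_wpM2l //; apply: le_trans q2.
    by rewrite ler_peMr.
  - have -> : s * m * (eps ^+ 2) ^+ 2 = (s * eps ^+ 2) * (m * eps ^+ 2) by ring.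
    rewrite sE mE.
    have -> : 50 ^+ 3 * q * (50 ^+ 3 * (q / K)) = (50 ^+ 3) ^+ 2 * (q ^+ 2 / K).
      by rewrite !expr2; ring.
    by rewrite ler_wpM2l // ler_pdivlMr.
  exists t, b, M; split => //; rewrite -/s.
  apply: le_trans (ler_wpM2l (ltW K0) h2) _.
  by rewrite /m le_eqVlt; apply/orP; left; apply/eqP; field; rewrite gt_eqF.
rewrite /s2; case: leP => h.
  have nK : 0 <= n%:R * K by rewrite mulr_ge0 // ltW.
  exists (Num.sqrt (n%:R * K)); split => //; last by rewrite sqr_sqrtr.
  rewrite -{1}[K]ger0_norm ?(ltW K0) // -sqrtr_sqr ler_sqrt ?nK //.
  by rewrite expr2 ler_wpM2r // ltW.
exists K; split => //; rewrite expr2 ler_wpM2r // ltW //.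
Qed.

End Bound.

(** Error budget: [1 / 10] for a false acceptance in the search, [1 / 10] for an exhausted search,
    [1 / 400] for the votes and [1 / 10] for a bad reference, in total below [1 / 3]. *)
Theorem theoremC1 :
  exists C : nat, (0 < C)%N /\
  forall (R : realType) (n k r : nat) (eps : R) (Q : 'I_n -> R),
    (2 <= k)%N -> 0 < eps -> eps <= 1 -> is_dist Q ->
    (1 <= r)%N -> (r <= k.-1)%N ->
    exists T : alg n k,
      (num_samples T)%:R <= C%:R * sample_bound n k r eps /\
      forall (P : 'I_n -> R) (I : {set 'I_k}),
        is_dist P -> eps <= dTV P Q -> #|I| = r ->
        prob_out (fun i => if i \in I then P else Q)
                 (correct_partition I) T >= 2/3.
Proof.
(* The search costs at most [40 * 64 * 4 = 10240] and the classification [2 + 2 * 64 = 130] times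
   [50 ^ 3] times the matching term of the bound; [2 ^ 14] exceeds both. *)
exists (2 ^ 14 * 50 ^ 3)%N; split; first by rewrite muln_gt0 !expn_gt0.
move=> R n k r eps Q k2 eps0 eps1 distQ r0 rk1.
have k0 : (0 < k)%N by apply: leq_trans k2.
have rk : (r <= k)%N := leq_trans rk1 (leq_pred k).
have n0 : (0 < n)%N.
  case: n Q distQ => [|//] Q [_]; rewrite big_ord0 => /eqP.
  by rewrite eq_sym oner_eq0.
have [e [flatQ card_e]] := exists_flattening n0 distQ.
have [t1 [b1 [m1 [ok1 c1]]]] := search_sizes n0 eps0 eps1.
have [t2 [b2 [m2 [ok2 c2 c3]]]] := classification_sizes n0 k2 eps0 eps1.
(* [l] serves twice: [2 ^ l] lies between [k] and [2 * k], as [pick_index_hit] requires, and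
   [16 * l] votes suffice by [vote_count_suffices]. *)
pose l := (trunc_log 2 k).+1; pose L := (16 * l)%N; pose N := (20 * (k %/ r).+1)%N.
have kr0 : 0 < k%:R :> R by rewrite ltr0n.
have rr0 : 0 < r%:R :> R by rewrite ltr0n.
have k1r : 1 <= k%:R :> R by rewrite ler1n.
have Nle : N%:R <= 40 * (k%:R / r%:R) :> R.
  rewrite mulrA ler_pdivlMr // -!natrM ler_nat /N.
  have h : ((k %/ r).+1 * r <= 2 * k)%N by rewrite mulSn mul2n -addnn leq_add ?leq_divM.
  by rewrite -[40%N]/(20 * 2)%N -!mulnA leq_mul2l h orbT.
have Nge : 20 * (k%:R / r%:R) <= N%:R :> R.
  rewrite mulrA ler_pdivrMr // -!natrM ler_nat /N -mulnA leq_mul2l /=.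
  by rewrite mulnC ltnW // mulnC ltn_ceil.
have kl : (k < 2 ^ l)%N by apply: trunc_log_ltn.
have lk : (2 ^ l <= 2 * k)%N.
  by rewrite expnS leq_mul2l; have /andP[] := trunc_log_bounds (isT : 1 < 2)%N k0.
have aL := vote_count_suffices R k0 kl; rewrite -/L in aL.
have lnk : l%:R <= 4 * ln (k%:R : R) by apply: trunc_logS_le.
exists (to_alg (cluster Q e k0 L N l t1 b1 m1 t2 b2 m2)); split.
  rewrite num_samples_to_alg.
  apply: (@le_trans _ _ (N * (L * (b1 * t1 + m1)) + (b2 * t2 + k * (L * m2)))%:R).
    by rewrite ler_nat cost_cluster.
  rewrite /sample_bound natrD natrD [(N * _)%:R]natrM [(L * (_ + _))%:R]natrM.
  rewrite [(k * (L * m2))%:R]natrM [(L * m2)%:R]natrM.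
  rewrite [(2 ^ 14 * 50 ^ 3)%:R]natrM !natrX.
  set s2 := (if _ then _ else _) in c2 c3 *.
  set c : R := 50 ^+ 3 in c1 c2 c3 *.
  have Lle : L%:R <= 64 * ln (k%:R : R).
    by rewrite /L natrM; move: lnk; lra.
  have cost1 : N%:R * (L%:R * (b1 * t1 + m1)%:R) <=
     40 * (k%:R / r%:R) * ((64 * ln k%:R) * (4 * (c * (Num.sqrt n%:R / eps ^+ 2)))).
    apply: ler_pM => //; first by rewrite mulr_ge0.
    exact: ler_pM.
  have cost2 : k%:R * (L%:R * m2%:R) <= 64 * (2 * (c * s2)).
    apply: le_trans (ler_wpM2l (_ : 0 <= 64) c3); last by [].
    rewrite mulrA mulrA ler_wpM2r // mulrCA ler_wpM2l //.
  have s20 : 0 <= c * s2.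
    have : 0 <= (b2 * t2)%:R :> R by rewrite ler0n.
    move: c2; lra.
  have b10 : 0 <= c * (k%:R * ln k%:R * Num.sqrt n%:R / (r%:R * eps ^+ 2)).
    have lnk0 : 0 <= ln k%:R :> R by rewrite ln_ge0.
    by rewrite !mulr_ge0 ?sqrtr_ge0 ?exprn_ge0 // invr_ge0 mulr_ge0 // sqr_ge0.
  have E : 40 * (k%:R / r%:R) * ((64 * ln k%:R) * (4 * (c * (Num.sqrt n%:R / eps ^+ 2)))) =
     40 * 64 * 4 * (c * (k%:R * ln k%:R * Num.sqrt n%:R / (r%:R * eps ^+ 2))).
    by field; rewrite !gt_eqF.
  rewrite E in cost1; rewrite -mulrA mulrDr; move: c2 cost1 cost2 s20 b10.
  set X := c * (_ / _); set Y := c * s2; lra.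
move=> P I distP far cI.
have hL : (3 / 5) ^+ L <= 10^-1 :> R.
  apply: le_trans aL _; rewrite lef_pV2 ?posrE ?mulr_gt0 //; lra.
have := cluster_success k0 I distP distQ n0 eps0 eps1 far flatQ card_e N ok1 ok2
  (ltnW kl) lk hL.
apply: le_trans.
rewrite cI; set a : R := (3 / 5) ^+ L in aL hL *.
have ka : k%:R * a <= 400^-1.
  apply: le_trans (ler_wpM2l (ltW kr0) aL) _.
  by rewrite le_eqVlt; apply/orP; left; apply/eqP; field; rewrite gt_eqF.
have a0 : 0 <= a by rewrite exprn_ge0 // divr_ge0.
have Na : N%:R * a <= 10^-1.
  have h1 : N%:R <= 40 * k%:R :> R.
    apply: le_trans Nle _; rewrite ler_wpM2l // ler_pdivrMr // ler_peMr ?(ltW kr0) //.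
    by rewrite ler1n.
  have := ler_wpM2r a0 h1; lra.
set y := 9 / 10 * (r%:R / (2 * k%:R)).
have yk : y = 9 / 20 * (r%:R / k%:R) by rewrite /y; field; rewrite gt_eqF.
have y0 : 0 <= y by rewrite yk mulr_ge0 ?divr_ge0 // ltW.
have y1 : y <= 1.
  have : r%:R / k%:R <= 1 :> R by rewrite ler_pdivrMr // mul1r ler_nat.
  rewrite yk; lra.
(* Since [20 * (9 / 20) = 9], [expr1B_le] bounds the chance of an exhausted search by
   [1 / (1 + 9)]. *)
have Ny : 9 <= N%:R * y.
  have := ler_wpM2r y0 Nge.
  have -> : 20 * (k%:R / r%:R) * y = 9 by rewrite yk; field; rewrite !gt_eqF.
  by [].
have y01 : 0 <= y <= 1 by rewrite y0 y1.
have h := expr1B_le N y01; set X := (1 - y) ^+ N in h *.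
have X0 : 0 <= X by rewrite exprn_ge0 // subr_ge0.
have : X * 10 <= X * (1 + N%:R * y) by rewrite ler_wpM2l //; lra.
lra.
Qed.
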